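(* Let $d\ge1$ and let $\{p_i\}_{i\in\mathbb{Z}^d}$ be a strictly stationary Gaussian random field in $\mathbb{R}^d$ with mean $\mu\in\mathbb{R}^d$. Put $\Sigma:=\mathrm{Var}(p_0)$ and $C_i:=\mathrm{Cov}(p_i,p_0)$, $i\in\mathbb{Z}^d$, and assume that $$\Sigma=\sigma^2 I_d,\qquad C_i=\rho_i\Sigma,\quad i\in\mathbb{Z}^d,$$ with $\sigma^2>0$ and $\rho_i\in[-1,1]$. Let $\mathcal{A}:=\{i\in\mathbb{Z}^d\setminus\{0\}:\ \rho_i=1\}$. Then the $K$-function of the corresponding perturbed lattice $\Xi=\sum_{i\in\mathbb{Z}^d}\delta_{i+p_i+U}$ is $$K(r)=\#(\mathcal{A}\cap B(0,r))+\sum_{i\in\mathbb{Z}^d\setminus(\mathcal{A}\cup\{0\})}P_d\bigl(r^2/\kappa_i,\ |i|^2/\kappa_i\bigr),\qquad r\ge 0,$$ where $\kappa_i:=2\sigma^2(1-\rho_i)$ and $P_d(\cdot,\eta)$ denotes the cumulative distribution function of the non-central chi-squared distribution with $d$ degrees of freedom and non-centrality parameter $\eta$.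
   Context: $|\cdot|$ is the Euclidean norm, $B(0,r)$ is the closed Euclidean ball of radius $r$ centered at $0$, $\#$ denotes cardinality, and $I_d$ is the identity matrix. For random vectors, $\mathrm{Cov}(X,Y)=\mathbb{E}[(X-\mathbb{E}X)(Y-\mathbb{E}Y)^\top]$ and $\mathrm{Var}(X)=\mathrm{Cov}(X,X)$. A random field $\{p_i,i\in\mathbb{Z}^d\}$ is strictly stationary if $\{p_i,i\in\Lambda\}$ and $\{p_{i+j},i\in\Lambda\}$ have the same distribution for all $\Lambda\subset\mathbb{Z}^d$ and $j\in\mathbb{Z}^d$; it is Gaussian if all its finite-dimensional distributions are jointly Gaussian. The corresponding perturbed lattice is the stationary point process $\Xi=\sum_{i\in\mathbb{Z}^d}\delta_{i+p_i+U}$, where $U$ is uniformly distributed on the unit cube $[0,1)^d$ and independent of the field (its intensity is $1$, and it is almost surely simple). For a simple stationary point process $\Xi$ the reduced second factorial moment measure is $\mu^{(2)}_{\mathrm{red}}(B)=\mathbb{E}\sum_{x,y\in\Xi}^{\neq}\mathbf{1}\{x\in[0,1]^d,\ y-x\in B\}$ for Borel $B\subset\mathbb{R}^d$, the sum being over ordered pairs of distinct points, and the (Ripley) $K$-function is $K(r)=\mu^{(2)}_{\mathrm{red}}(B(0,r))$, $r\ge0$. The non-central chi-squared distribution with $d$ degrees of freedom and non-centrality parameter $\eta$ is the law of $|Z|^2$ for $Z\sim\mathcal{N}_d(m,I_d)$ with $|m|^2=\eta$. *)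

(* Defs.v *)
From HB Require Import structures.
From mathcomp Require Import all_boot all_order all_algebra.
From mathcomp Require Import all_classical all_reals all_analysis.
From mathcomp Require Import measurable_realfun.
Set Implicit Arguments.
Unset Strict Implicit.
Unset Printing Implicit Defensive.
Import Order.TTheory GRing.Theory Num.Theory.
Import numFieldNormedType.Exports.
Local Open Scope classical_set_scope.
Local Open Scope ring_scope.

Definition measure_row_display : measure_display -> measure_display.
Proof. exact. Qed.

(* 'rV[R]_n carries the product sigma-algebra of its n coordinates, as
   n.-tuple R does in the library; this is the Borel sigma-algebra of R^n. *)
Section measurable_row.
Variables (R : realType) (n : nat).

Definition row_coord (k : 'I_n) (x : 'rV[R]_n) : R := x 0 k.

Let row_set0 : g_sigma_preimage row_coord set0.
Proof. exact: sigma_algebra0. Qed.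

Let row_setC A : g_sigma_preimage row_coord A -> g_sigma_preimage row_coord (~` A).
Proof. exact: sigma_algebraC. Qed.

Let row_bigcup (F : (set 'rV[R]_n)^nat) :
  (forall i, g_sigma_preimage row_coord (F i)) ->
  g_sigma_preimage row_coord (\bigcup_i (F i)).
Proof. exact: sigma_algebra_bigcup. Qed.

HB.instance Definition _ := @isMeasurable.Build
  (measure_row_display default_measure_display) 'rV[R]_n
  (g_sigma_preimage row_coord) row_set0 row_setC row_bigcup.

Lemma measurable_row_coord k : measurable_fun [set: 'rV[R]_n] (row_coord k).
Proof.
move=> _ Y mY; rewrite setTI; apply: sub_sigma_algebra => /=.
rewrite -bigcup_seq/=; exists k => /=; first by rewrite mem_index_enum.
by exists Y => //; rewrite setTI.
Qed.

Lemma measurable_fun_rowP d (T : measurableType d) (f : T -> 'rV[R]_n) :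
  measurable_fun setT f <->
  forall k, measurable_fun setT (fun t => f t 0 k).
Proof.
split=> [mf k|mf].
  exact: (measurableT_comp (measurable_row_coord k) mf).
move=> _ A mA.
have : (g_sigma_preimage (fun k => row_coord k \o f)) (f @^-1` A).
  by rewrite g_sigma_preimage_comp; exists A => //; rewrite setTI.
rewrite setTI; move: (f @^-1` A).
apply: smallest_sub; first exact: sigma_algebra_measurable.
rewrite -bigcup_seq/=; apply: bigcup_sub => k _ B [C mC <-].
exact: mf.
Qed.

End measurable_row.

Section product_probability.
Variable R : realType.

Definition cons_row n (x : R * 'rV[R]_n) : 'rV[R]_n.+1 :=
  \row_k oapp (fun j => x.2 0 j) x.1 (unlift ord0 k).

Lemma measurable_cons_row n :
  measurable_fun [set: measurableTypeR R * 'rV[R]_n] (@cons_row n).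
Proof.
apply/measurable_fun_rowP => k.
have [j|] := unliftP ord0 k => ->.
  rewrite [X in measurable_fun _ X](_ : _ = @row_coord R n j \o snd).
    by apply: measurableT_comp => //; exact: measurable_row_coord.
  by apply/funext => x /=; rewrite mxE liftK.
rewrite [X in measurable_fun _ X](_ : _ = fst); first exact: measurable_fst.
by apply/funext => x /=; rewrite mxE unlift_none.
Qed.

HB.instance Definition _ n := isMeasurableFun.Build _ _ _ _
  (@cons_row n : measurableTypeR R * 'rV[R]_n -> 'rV[R]_n.+1)
  (@measurable_cons_row n).

(* The product of the probabilities Q 0, ..., Q (n - 1) on R^n: the law of a
   vector with independent coordinates of laws Q k. *)
Fixpoint product_probability n :
    ('I_n -> probability (measurableTypeR R) R) -> probability 'rV[R]_n R :=
  match n with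
  | 0%N => fun=> \d_(0 : 'rV[R]_0)
  | m.+1 => fun Q =>
      distribution (Q ord0 \x product_probability (fun k => Q (lift ord0 k)))%E
                   (@cons_row m)
  end.

Definition uniform_cube n : probability 'rV[R]_n R :=
  product_probability (fun=> uniform_prob (@ltr01 R)).

(* N_n(m, I_n) *)
Definition standard_normal_at n (m : 'rV[R]_n) : probability 'rV[R]_n R :=
  product_probability (fun k => normal_prob (m 0 k) 1).

End product_probability.

Section euclidean.
Variables (R : realType) (n : nat).

Definition sqnorm (x : 'rV[R]_n) : R := \sum_(k < n) x 0 k ^+ 2.

(* The library's norm on 'rV[R]_n is the sup norm. *)
Definition enorm (x : 'rV[R]_n) : R := Num.sqrt (sqnorm x).

Definition eball (r : R) : set 'rV[R]_n := [set x | enorm x <= r].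

Definition unit_cube : set 'rV[R]_n := [set x | forall k, 0 <= x 0 k <= 1].

Lemma measurable_sqnorm : measurable_fun setT sqnorm.
Proof.
apply: measurable_sum => k; apply: measurable_funX.
exact: measurable_row_coord.
Qed.

HB.instance Definition _ := isMeasurableFun.Build _ _ _ _ sqnorm measurable_sqnorm.

Definition lattice_point (i : 'rV[int]_n) : 'rV[R]_n := map_mx intr i.

(* The law of |Z|^2 for Z ~ N_n(m, I_n) depends on m through |m|^2 only; the
   mean used here is m = (sqrt eta, 0, ..., 0). *)
Definition noncentral_chi2_cdf (x eta : R) : \bar R :=
  cdf (P := standard_normal_at
              (\row_(k < n) if k == 0%N :> nat then Num.sqrt eta else 0))
      sqnorm x.

End euclidean.
Arguments noncentral_chi2_cdf {R} n x eta.

Section random_fields.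
Context {R : realType} {dT : measure_display} {T : measurableType dT}.
Variables (P : probability T R) (d : nat).
Implicit Types (p : 'rV[int]_d -> T -> 'rV[R]_d) (U : T -> 'rV[R]_d).

(* The product sigma-algebra of (R^d)^L, seen as a sigma-algebra of sets of
   fields on Z^d. *)
Definition field_events (L : set 'rV[int]_d) :
    set (set ('rV[int]_d -> 'rV[R]_d)) :=
  <<s [set A | exists2 i, L i &
        exists2 B, measurable B & A = [set f | B (f i)]] >>.

Definition strictly_stationary p :=
  forall (L : set 'rV[int]_d) (j : 'rV[int]_d) A, field_events L A ->
    P [set w | A (fun i => p i w)] = P [set w | A (fun i => p (i + j) w)].

(* Constants are Gaussian; normal_prob m 0 is a junk value in the library. *)
Definition is_gaussian (X : T -> R) :=
  exists m s : R, 0 <= s /\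
    forall B : set (measurableTypeR R), measurable B ->
      P (X @^-1` B) = if s == 0 then \d_m B else normal_prob m s B.

(* A finite family is jointly Gaussian when all linear combinations of all its
   coordinates are. *)
Definition gaussian_field p :=
  forall (s : seq 'rV[int]_d) (a : 'rV[int]_d -> 'rV[R]_d),
    is_gaussian (fun w => \sum_(i <- s) \sum_(k < d) a i 0 k * p i w 0 k).

Definition has_mean p (mu : 'rV[R]_d) :=
  forall i k, ('E_P[(fun w => p i w 0 k)%R])%E = (mu 0 k)%:E.

Definition covariance_mx (X Y : T -> 'rV[R]_d) : 'M[R]_d :=
  \matrix_(k, l)
    fine (covariance P (fun w => X w 0 k) (fun w => Y w 0 l)).

Definition has_law (X : T -> 'rV[R]_d) (Q : probability 'rV[R]_d R) :=
  forall B, measurable B -> P (X @^-1` B) = Q B.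

Definition independent_of_field U p :=
  forall B A, measurable B -> field_events setT A ->
    P (U @^-1` B `&` [set w | A (fun i => p i w)]) =
    (P (U @^-1` B) * P [set w | A (fun i => p i w)])%E.

(* A point process is a random counting measure Xi w; its points are the atoms
   of Xi w. *)
Definition points (nu : set 'rV[R]_d -> \bar R) : set 'rV[R]_d :=
  [set x | (0 < nu [set x])%E].

Definition perturbed_lattice p U (w : T) (A : set 'rV[R]_d) : \bar R :=
  (\esum_(i in [set: 'rV[int]_d]) \d_((lattice_point R i + p i w + U w)%R) A)%E.

(* For simple point processes: multiplicities are not counted. *)
Definition reduced_moment2 (Xi : T -> set 'rV[R]_d -> \bar R)
    (B : set 'rV[R]_d) : \bar R :=
  (\int[P]_w
    \esum_(xy in [set xy : 'rV[R]_d * 'rV[R]_d |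
                    [/\ points (Xi w) xy.1, points (Xi w) xy.2 & xy.1 <> xy.2]])
      (\1_[set xy : 'rV[R]_d * 'rV[R]_d |
             unit_cube xy.1 /\ B (xy.2 - xy.1)%R] xy)%:E)%E.

Definition K_function (Xi : T -> set 'rV[R]_d -> \bar R) (r : R) : \bar R :=
  reduced_moment2 Xi (eball r).

End random_fields.

(* Main.v *)
(** Up to a null set the points [i + p_i + U] are pairwise distinct, so [K r] is
    the sum over [i <> j] of the probabilities that [i + p_i + U] lies in the
    unit cube and [(j - i) + p_j - p_i] in the ball. By stationarity and
    independence [(p_i, p_j)] may be replaced by [(p_0, p_(j-i))]; since almost
    surely exactly one lattice translate of [p_0 + U] lies in the cube, summing
    over [i] leaves the sum over [k <> 0] of [P (|k + p_k - p_0| <= r)]. The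
    vector [p_k - p_0] is centred Gaussian with covariance [kappa_k I], hence
    zero almost surely if [rho_k = 1]. Otherwise a reflection moves the mean of
    [(k + p_k - p_0) / sqrt kappa_k] to the first axis, and a Cramer-Wold theorem
    reduces the comparison with a product of normal laws to one-dimensional
    projections. *)
From HB Require Import structures.
Require Import Defs.
From mathcomp Require Import all_boot all_order all_algebra.
From mathcomp Require Import all_classical all_reals all_analysis.
From mathcomp Require Import measurable_realfun ring lra.
Set Implicit Arguments.
Unset Strict Implicit.
Unset Printing Implicit Defensive.
Import Order.TTheory GRing.Theory Num.Theory.
Import numFieldNormedType.Exports.
Local Open Scope classical_set_scope.
Local Open Scope ring_scope.

(** Joint Gaussianity is available only through one-dimensional laws: each linear form of the field
    has some parameters [m] and [s], possibly with [s = 0], and no joint density is given. The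
    parameters are therefore recovered from moments, which requires the mean and the second moment
    of the standard normal law; degenerate and nondegenerate laws are treated together as affine
    images of that law. The Cramer-Wold theorem is obtained without Fourier inversion: cosines of
    linear forms have expectations fixed by the projections, products of them are again sums of such
    cosines, and bounded pointwise limits lead to all Borel indicators. For the point process, the
    integrand of [K_function] runs over atoms and has no evident measurability, so it is replaced
    off a null set by a sum over pairs of indices. Translates of the closed unit cube overlap in
    faces; these are avoided almost surely because, given the field, no coordinate of [U] has an
    atom. Stationarity concerns the field alone, and independence extends it to events that also
    involve [U]. *)

(* [pushforward] alone does not elaborate to a measure: its instance takes the
   measurability of [f] as an argument. *)
Definition image_measure d1 d2 (T1 : measurableType d1) (T2 : measurableType d2)
    (R : realType) (mu : {measure set T1 -> \bar R}) (f : T1 -> T2)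
    (mf : measurable_fun setT f) : {measure set T2 -> \bar R} :=
  measure_function_pushforward__canonical__measure_function_Measure mu mf.

(** * One-dimensional Gaussian laws *)

Section density.
Local Open Scope ereal_scope.
Context d (T : measurableType d) (R : realType).
Variables (mu nu : {measure set T -> \bar R}) (h : T -> R).
Hypothesis mh : measurable_fun setT h.
Hypothesis h0 : forall x, (0 <= h x)%R.
Hypothesis nuE : forall B, measurable B -> nu B = \int[mu]_(x in B) (h x)%:E.

Import HBNNSimple.

Let integral_density_nnsfun (f : {nnsfun T >-> R}) :
  \int[nu]_x (f x)%:E = \int[mu]_x ((f x)%:E * (h x)%:E).
Proof.
have mhE : measurable_fun setT (EFin \o h) by exact/measurable_EFinP.
under [LHS]eq_integral do rewrite fimfunE -fsumEFin//.
rewrite [LHS]ge0_integral_fsum//; last 2 first.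
  - by move=> r; exact/measurable_EFinP/measurableT_comp.
  - by move=> n x _; exact: (nnfun_muleindic_ge0 f).
under [RHS]eq_integral.
  move=> x xD; rewrite fimfunE -fsumEFin// ge0_mule_fsuml; last first.
    by move=> r; exact: (nnfun_muleindic_ge0 f).
  over.
rewrite [RHS]ge0_integral_fsum//; last 2 first.
  - move=> r; apply: emeasurable_funM => //.
    exact/measurable_EFinP/measurableT_comp.
  - by move=> n x _; rewrite mule_ge0 ?lee_fin//; exact: (nnfun_muleindic_ge0 f).
apply: eq_fsbigr => r _.
rewrite integralZl_indic_nnsfun//= integral_indic// setIT nuE//.
under [RHS]eq_integral do rewrite EFinM -muleA.
(* Membership of [r] in the range of [f] has been discarded, so a negative [r] can occur; its fibre
   is empty. *)
have [r0|r0] := leP 0%R r.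
  rewrite ge0_integralZl//; last 2 first.
    - apply: emeasurable_funM => //; exact/measurable_EFinP.
    - by move=> x _; rewrite mule_ge0 ?lee_fin.
  congr (_ * _); rewrite [LHS]integral_mkcond; apply: eq_integral => x _.
  rewrite patchE indicE; case: ifPn => _; rewrite ?mul1e ?mul0e//.
have -> : f @^-1` [set r] = set0.
  by apply/seteqP; split => // x /= fxr; move: r0; rewrite -fxr ltNge fun_ge0.
rewrite integral_set0 mule0; apply/esym; rewrite integral0_eq// => x _.
by rewrite indic0 mul0e mule0.
Qed.

(** Monotone convergence along simple functions. It turns integrals against a normal law into
    Lebesgue integrals weighted by the density. *)
Lemma integral_density (f : T -> \bar R) :
  measurable_fun setT f -> (forall x, 0 <= f x) ->
  \int[nu]_x f x = \int[mu]_x (f x * (h x)%:E).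
Proof.
move=> mf f0; pose f_ := nnsfun_approx measurableT mf.
have mhE : measurable_fun setT (EFin \o h) by exact/measurable_EFinP.
transitivity (lim (\int[nu]_x (f_ n x)%:E @[n --> \oo])).
  rewrite -monotone_convergence//=.
  - apply: eq_integral => ? /[!inE] xD; apply/esym/cvg_lim => //=.
    exact: cvg_nnsfun_approx.
  - by move=> n; exact/measurable_EFinP/measurable_funTS.
  - by move=> n ? _; rewrite lee_fin.
  - by move=> ? _ ? ? mn; rewrite lee_fin; exact/lefP/nd_nnsfun_approx.
transitivity (lim (\int[mu]_x ((f_ n x)%:E * (h x)%:E) @[n --> \oo])).
  by apply: congr_lim; apply/funext => n; exact: integral_density_nnsfun.
rewrite -monotone_convergence//=.
- apply: eq_integral => x /[!inE] xD; apply/cvg_lim => //=.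
  apply: cvgeZr; first by [].
  exact: cvg_nnsfun_approx.
- by move=> n; apply: emeasurable_funM => //; exact/measurable_EFinP.
- by move=> n x _; rewrite mule_ge0 ?lee_fin.
- move=> x _ a b ab; rewrite lee_wpmul2r ?lee_fin//.
  exact/lefP/nd_nnsfun_approx.
Qed.

End density.

(** * Affine changes of variable for Lebesgue measure *)

Section lebesgue_affine.
Variable R : realType.
Notation mu := (@lebesgue_measure R).

Lemma measurable_affine (m s : R) :
  measurable_fun [set: measurableTypeR R]
    ((fun z => m + s * z) : measurableTypeR R -> measurableTypeR R).
Proof. by apply: measurable_funD => //; exact: measurable_funM. Qed.

(** By uniqueness of Lebesgue measure only half-open intervals matter. A negative slope exchanges
    the open and the closed end, which leaves the length unchanged. *)
Lemma lebesgue_measure_affine (m s : R) A : s != 0 -> measurable A ->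
  (`|s|%:E * mu ((fun z => m + s * z)%R @^-1` A) = mu A)%E.
Proof.
move=> s0 mA.
pose f : measurableTypeR R -> measurableTypeR R := fun z => m + s * z.
pose nu := image_measure
  mu (measurable_affine m s).
rewrite -[LHS]/(mscale (NngNum (normr_ge0 s)) nu A).
apply/esym/lebesgue_measure_unique => // _ [[a b] _ <-].
rewrite -[RHS]/(`|s|%:E * mu (f @^-1` `]a, b]%classic))%E /=.
have [s_gt0|s_lt0] : 0 < s \/ s < 0 by move: s0; rewrite neq_lt => /orP[]; auto.
- have -> : f @^-1` `]a, b] = `](a - m) / s, (b - m) / s]%classic.
    apply/seteqP; split => x /=; rewrite /f !in_itv/= ltr_pdivrMr// ler_pdivlMr//.
      by move=> /andP[? ?]; apply/andP; split; lra.
    by move=> /andP[? ?]; apply/andP; split; lra.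
  rewrite !lebesgue_measure_itv/= !lte_fin ltr_pM2r ?invr_gt0// ltrD2r.
  case: ifPn => _; last by rewrite mule0.
  by rewrite -!EFinB -EFinM gtr0_norm//; congr EFin; field.
- have -> : f @^-1` `]a, b] = `[(b - m) / s, (a - m) / s[%classic.
    apply/seteqP; split => x /=; rewrite /f !in_itv/= ltr_ndivlMr// ler_ndivrMr//.
      by move=> /andP[? ?]; apply/andP; split; lra.
    by move=> /andP[? ?]; apply/andP; split; lra.
  rewrite !lebesgue_measure_itv/= !lte_fin ltr_nM2r ?invr_lt0// ltrD2r.
  case: ifPn => _; last by rewrite mule0.
  by rewrite -!EFinB -EFinM ltr0_norm//; congr EFin; field.
Qed.

Lemma ge0_integral_affine (m s : R) (g : R -> \bar R) : s != 0 ->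
  measurable_fun setT g -> (forall x, 0 <= g x)%E ->
  (\int[mu]_x g x = `|s|%:E * \int[mu]_x g (m + s * x)%R)%E.
Proof.
move=> s0 mg g0.
pose f : measurableTypeR R -> measurableTypeR R := fun z => m + s * z.
have mf : measurable_fun setT f by exact: measurable_affine.
have -> : (\int[mu]_x g (m + s * x)%R = \int[pushforward mu f]_x g x)%E.
  by rewrite ge0_integral_pushforward.
pose nu := image_measure
  mu mf.
rewrite -[X in (_ * X)%E]/(\int[nu]_x g x)%E.
rewrite -(@ge0_integral_mscale _ _ _ nu _ measurableT (NngNum (normr_ge0 s)))//.
apply: eq_measure_integral => A mA _.
exact/esym/(lebesgue_measure_affine m s0).
Qed.

End lebesgue_affine.

(** * Normal laws as affine images of the standard one *)

Section normal_affine.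
Variable R : realType.
Notation mu := (@lebesgue_measure R).
Notation N01 := (normal_prob (0 : R) 1).

Lemma normal_pdf_affine (m s x : R) : s != 0 ->
  `|s| * normal_pdf m s (m + s * x) = normal_pdf 0 1 x.
Proof.
move=> s0; rewrite !normal_pdfE ?oner_neq0// mulrA; congr (_ * _).
  rewrite /normal_peak expr1n mul1r -mulrnAr sqrtrM ?sqr_ge0// sqrtr_sqr invfM.
  by rewrite mulrA divff ?normr_eq0// mul1r.
by rewrite /normal_fun; congr expR; field.
Qed.

Lemma normal_prob_affine (m s : R) (B : set (measurableTypeR R)) :
  s != 0 -> measurable B ->
  normal_prob m s B = N01 ((fun z => m + s * z) @^-1` B).
Proof.
move=> s0 mB; rewrite /normal_prob integral_mkcond.
rewrite (ge0_integral_affine m s0); last 2 first.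
- apply/(measurable_restrictT _ _).1 => //.
  by apply/measurable_EFinP/measurable_funTS; exact: measurable_normal_pdf.
- by move=> x; rewrite patchE; case: ifP => // _; rewrite lee_fin normal_pdf_ge0.
rewrite -ge0_integralZl//; last 2 first.
- apply: (measurableT_comp _ (measurable_affine m s)).
  apply/(measurable_restrictT _ _).1 => //.
  by apply/measurable_EFinP/measurable_funTS; exact: measurable_normal_pdf.
- by move=> x _; rewrite patchE; case: ifP => // _; rewrite lee_fin normal_pdf_ge0.
rewrite [RHS]integral_mkcond; apply: eq_integral => x _.
rewrite !patchE (_ : (x \in _ @^-1` B) = (m + s * x \in B)); last first.
  by apply/idP/idP; rewrite !inE.
case: ifPn => _; last by rewrite mule0.
by rewrite -EFinM normal_pdf_affine.
Qed.

End normal_affine.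

Section gauss_law.
Variable R : realType.
Notation mu := (@lebesgue_measure R).
Notation N01 := (normal_prob (0 : R) 1).

(* [gauss_law m 0] is the Dirac mass at [m]. *)
Definition gauss_law (m s : R) (B : set (measurableTypeR R)) : \bar R :=
  N01 ((fun z => m + s * z) @^-1` B).

Lemma measurable_affine_preimage (m s : R) (B : set (measurableTypeR R)) :
  measurable B -> measurable ((fun z => m + s * z) @^-1` B).
Proof.
by move=> mB; rewrite -[X in measurable X]setTI; exact: measurable_affine.
Qed.

Lemma gauss_law_dirac m B : gauss_law m 0 B = \d_m B.
Proof.
rewrite /gauss_law diracE; have [mB|mB] := boolP (m \in B).
  rewrite (_ : _ @^-1` _ = setT) ?probability_setT//.
  apply/seteqP; split => // z _ /=; rewrite mul0r addr0; exact: set_mem.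
rewrite (_ : _ @^-1` _ = set0) ?measure0//.
apply/seteqP; split => // z /=; rewrite mul0r addr0 => /mem_set.
by rewrite (negbTE mB).
Qed.

Lemma gauss_law_normal m s B : s != 0 -> measurable B ->
  gauss_law m s B = normal_prob m s B.
Proof. by move=> s0 mB; rewrite normal_prob_affine. Qed.

Lemma normal_pdf_sqr (m s t x : R) : s ^+ 2 = t ^+ 2 ->
  normal_pdf m s x = normal_pdf m t x.
Proof.
move=> st; rewrite /normal_pdf /normal_peak /normal_fun st.
by rewrite -(sqrf_eq0 s) st sqrf_eq0.
Qed.

(** The density depends on the scale through its square only. Hence a variance determines the law
    although the sign of the scale is unknown, and [N01] is symmetric. *)
Lemma gauss_law_sqr m s t B : s ^+ 2 = t ^+ 2 -> measurable B ->
  gauss_law m s B = gauss_law m t B.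
Proof.
move=> st mB; have st0 : (s == 0) = (t == 0).
  by rewrite -(sqrf_eq0 s) st sqrf_eq0.
have [/eqP t0|t0] := boolP (t == 0).
  by move: st0; rewrite t0 eqxx => /eqP ->.
have s0 : s != 0 by rewrite st0.
rewrite (gauss_law_normal _ s0 mB) (gauss_law_normal _ t0 mB).
by apply: eq_integral => x _; rewrite (normal_pdf_sqr _ _ st).
Qed.

Lemma normal_peakE (s : R) : normal_peak s = `|s|^-1 * normal_peak 1.
Proof.
by rewrite /normal_peak expr1n mul1r -mulrnAr sqrtrM ?sqr_ge0// sqrtr_sqr invfM.
Qed.

(* Completing the square in the exponent. *)
Lemma normal_pdf_conv (m s t x y : R) : t != 0 ->
  let r := Num.sqrt (s ^+ 2 + t ^+ 2) in
  normal_pdf (m + s * y) t x * normal_pdf 0 1 y =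
  normal_pdf m r x * normal_pdf (s * (x - m) / r ^+ 2) (t / r) y.
Proof.
move=> t0 r.
have r2 : r ^+ 2 = s ^+ 2 + t ^+ 2 by rewrite sqr_sqrtr// addr_ge0 ?sqr_ge0.
have rst : s ^+ 2 + t ^+ 2 != 0.
  by rewrite gt_eqF// ltr_wpDl ?sqr_ge0// exprn_even_gt0.
have r0 : r != 0 by rewrite -sqrf_eq0 r2.
have tr0 : t / r != 0 by rewrite mulf_neq0// invr_eq0.
rewrite !normal_pdfE ?oner_neq0// !mulrA [_ * _ * normal_peak 1]mulrAC.
rewrite [_ * _ * normal_peak (t / r)]mulrAC -!mulrA [LHS]mulrA [RHS]mulrA.
congr (_ * _).
  rewrite (normal_peakE t) (normal_peakE r) (normal_peakE (t / r)).
  rewrite normf_div invfM invrK; move: (normal_peak 1) => p.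
  have nt0 : `|t| != 0 by rewrite normr_eq0.
  have nr0 : `|r| != 0 by rewrite normr_eq0.
  by move: `|t| `|r| nt0 nr0 => u v u0 v0; field; rewrite u0 v0.
rewrite /normal_fun -!expRD; congr expR.
rewrite expr_div_n r2; field.
by rewrite t0 rst.
Qed.

(** Moving the mean into the argument gives joint measurability in both variables, since
    [measurable_normal_pdf] concerns the argument alone. *)
Lemma normal_pdf_shift (m t x y : R) : t != 0 ->
  normal_pdf (m + y) t x = normal_pdf m t (x - y).
Proof.
by move=> t0; rewrite !normal_pdfE// /normal_fun opprD addrA addrAC.
Qed.

Let measurable_shift (m s t : R) (B : set (measurableTypeR R)) :
  measurable B ->
  measurable_fun [set: measurableTypeR R * measurableTypeR R]
    (fun z => (normal_pdf m t (z.1 - s * z.2) * \1_B z.1)%:E : \bar R).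
Proof.
move=> mB; apply/measurable_EFinP.
apply: measurable_funM; last first.
  exact: (measurableT_comp (measurable_indic mB) measurable_fst).
apply: (measurableT_comp (measurable_normal_pdf m t)).
apply: measurable_funB; first exact: measurable_fst.
by apply: measurable_funM => //; exact: measurable_snd.
Qed.

Let measurable_conv (m s t : R) (B : set (measurableTypeR R)) :
  measurable B ->
  measurable_fun [set: measurableTypeR R * measurableTypeR R]
    (fun z => (normal_pdf m t (z.1 - s * z.2) * \1_B z.1)%:E *
               (normal_pdf 0 1 z.2)%:E : \bar R)%E.
Proof.
move=> mB; apply: emeasurable_funM; first exact: measurable_shift.
apply/measurable_EFinP.
exact: (measurableT_comp (measurable_normal_pdf 0 1) measurable_snd).
Qed.

Lemma integral_N01 (f : R -> \bar R) :
  measurable_fun [set: measurableTypeR R] f -> (forall x, 0 <= f x)%E ->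
  (\int[N01]_x f x = \int[mu]_x (f x * (normal_pdf 0 1 x)%:E))%E.
Proof.
move=> mf f0; apply: integral_density => //; first exact: measurable_normal_pdf.
by move=> x; exact: normal_pdf_ge0.
Qed.

(** The sum of two independent normal variables is normal, written as a mixture over the first of
    them. *)
Lemma gauss_law_conv (m s t : R) (B : set (measurableTypeR R)) : measurable B ->
  (\int[N01]_y gauss_law (m + s * y)%R t B =
   gauss_law m (Num.sqrt (s ^+ 2 + t ^+ 2)) B)%E.
Proof.
(* For [t = 0] there is no density: the integrand is a Dirac mass and the integral is the law of
   [m + s * y] itself. *)
move=> mB; have [->|t0] := eqVneq t 0.
  rewrite expr0n/= addr0 sqrtr_sqr.
  under eq_integral do rewrite gauss_law_dirac diracE.
  rewrite (@gauss_law_sqr m `|s| s) ?real_normK ?num_real//.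
  have mBs := measurable_affine_preimage m s mB.
  transitivity (\int[N01]_x (\1_((fun z => m + s * z) @^-1` B) x)%:E)%E.
    apply: eq_integral => x _; rewrite indicE.
    by congr ((nat_of_bool _)%:R)%:E; apply/idP/idP; rewrite !inE.
  by rewrite integral_indic// setIT.
have [r0 v0] : Num.sqrt (s ^+ 2 + t ^+ 2) != 0 /\
    t / Num.sqrt (s ^+ 2 + t ^+ 2) != 0.
  have : 0 < s ^+ 2 + t ^+ 2 by rewrite ltr_wpDl ?sqr_ge0// exprn_even_gt0.
  rewrite -sqrtr_gt0 => /lt0r_neq0 r0.
  by rewrite mulf_neq0 ?invr_eq0.
have lawE y : gauss_law (m + s * y) t B =
    (\int[mu]_x (normal_pdf m t (x - s * y) * \1_B x)%:E)%E.
  rewrite (gauss_law_normal _ t0 mB) /normal_prob integral_mkcond.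
  apply: eq_integral => x _; rewrite patchE indicE normal_pdf_shift//.
  by case: ifPn; rewrite ?mulr1 ?mulr0.
have shift_ge0 x y : (0 <= (normal_pdf m t (x - s * y) * \1_B x)%:E)%E.
  by rewrite lee_fin mulr_ge0// normal_pdf_ge0.
rewrite (gauss_law_normal _ r0 mB) integral_N01; last 2 first.
- under eq_fun do rewrite lawE.
  apply: (measurable_fun_fubini_tonelli_G (m1 := mu)
    (fun z => (normal_pdf m t (z.1 - s * z.2) * \1_B z.1)%:E)) => //.
  exact: measurable_shift.
- by move=> x; exact: measure_ge0.
have m_shift y : measurable_fun setT
    (fun x : measurableTypeR R => (normal_pdf m t (x - s * y) * \1_B x)%:E).
  exact: (measurableT_comp (measurable_shift m s t mB) (measurable_pair2 y)).
under eq_integral do rewrite lawE -ge0_integralZr ?lee_fin ?normal_pdf_ge0//.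
rewrite -(fubini_tonelli (m1 := mu) (m2 := mu) (fun z =>
   (normal_pdf m t (z.1 - s * z.2) * \1_B z.1)%:E * (normal_pdf 0 1 z.2)%:E)%E)
   ; last 2 first.
- exact: measurable_conv.
- by move=> z; rewrite mule_ge0// lee_fin normal_pdf_ge0.
rewrite /normal_prob [RHS]integral_mkcond; apply: eq_integral => x _ /=.
rewrite patchE; case: ifPn => xB; last first.
  rewrite integral0_eq// => y _.
  by rewrite indicE (negbTE xB) mulr0 mul0e.
set r := Num.sqrt _ in r0 v0 *.
(* Completing the square leaves a factor free of [y] and a normal density in [y], whose total mass
   is 1. *)
transitivity (\int[mu]_y ((normal_pdf m r x)%:E *
    (normal_pdf (s * (x - m) / r ^+ 2) (t / r) y)%:E))%E.
  apply: eq_integral => y _.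
  by rewrite indicE xB mulr1 -!EFinM -normal_pdf_shift// normal_pdf_conv.
rewrite ge0_integralZl//.
- by rewrite integral_normal_pdf mule1.
- by apply/measurable_EFinP; exact: measurable_normal_pdf.
- by move=> y _; rewrite lee_fin normal_pdf_ge0.
- by rewrite lee_fin normal_pdf_ge0.
Qed.

End gauss_law.

(** * The second moment of the standard normal law *)

Section normal_moments.
Variable R : realType.
Notation mu := (@lebesgue_measure R).
Notation N01 := (normal_prob (0 : R) 1).
Let phi : R -> R := normal_pdf 0 1.

Let phiE x : phi x = normal_peak 1 * expR (- (x ^+ 2 / 2)).
Proof.
by rewrite /phi normal_pdfE ?oner_neq0// /normal_fun subr0 expr1n mulNr.
Qed.

Let phi_ge0 x : 0 <= phi x. Proof. exact: normal_pdf_ge0. Qed.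

Let continuous_phi : continuous phi.
Proof. by apply: continuous_normal_pdf; exact: oner_neq0. Qed.

Let is_derive_phi (x : R) : is_derive x 1 phi (- (x * phi x)).
Proof.
have -> : phi = normal_peak 1 \*: (expR \o (fun y => - (y ^+ 2 / 2))).
  by apply/funext => y; rewrite phiE.
pose g : R -> R := (fun y : R => - (y ^+ 2 / 2)).
have dg : is_derive x 1 g (- x).
  have -> : g = (- 2^-1) \*: (@id R ^+ 2).
    by apply/funext => y; rewrite /g /= -[RHS]/(- 2^-1 * y ^+ 2) mulNr mulrC.
  have H := is_deriveZ (- 2^-1) (is_deriveX 2 (is_derive_id x (1 : R))).
  apply: (is_derive_eq H).
  by rewrite -[LHS]/(- 2^-1 * ((2 * x ^+ 1) * 1)) expr1; field.
have := @is_derive1_comp R expR g x _ _ (is_derive_expR _) dg.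
move=> /(is_deriveZ (normal_peak 1)) H; apply: (is_derive_eq H).
rewrite -[LHS]/(_ * _) -[(normal_peak 1 \*: (expR \o g)) x]/(normal_peak 1 * expR (g x)).
by ring.
Qed.

(** An antiderivative of [(1 - x ^+ 2) * phi x] that vanishes at 0 and at infinity, so that [phi]
    and [x ^+ 2 * phi x] have the same integral over the half-line. *)
Let G x := x * phi x.

Let is_derive_G (x : R) : is_derive x 1 G ((1 - x ^+ 2) * phi x).
Proof.
have -> : G = (@id R) * phi by [].
have H := is_deriveM (is_derive_id x (1 : R)) (is_derive_phi x).
apply: (is_derive_eq H).
by rewrite -[LHS]/(x * _ + phi x * 1); ring.
Qed.

Let cvg_G : G x @[x --> +oo] --> (0 : R).
Proof.
apply/cvgr0Pnorm_lt => e e0; near=> x.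
have x0 : 0 < x by near: x; exact: nbhs_pinfty_gt.
rewrite ger0_norm; last by rewrite mulr_ge0// ltW.
(* The threshold comes from [expR (- u) <= u^-1] at [u = x ^+ 2 / 2], which gives
   [G x <= normal_peak 1 * 2 / x]. *)
have xe : normal_peak 1 * 2 / e < x.
  by near: x; apply: nbhs_pinfty_gt; exact: num_real.
rewrite /G phiE expRN.
have h : x ^+ 2 / 2 <= expR (x ^+ 2 / 2).
  by apply: le_trans (expR_ge1Dx _); rewrite lerDr.
have h0 : 0 < x ^+ 2 / 2 by rewrite divr_gt0// exprn_gt0.
apply: (@le_lt_trans _ _ (x * (normal_peak 1 * (x ^+ 2 / 2)^-1))).
  by rewrite ler_pM2l// ler_wpM2l ?normal_peak_ge0// lef_pV2// posrE expR_gt0.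
have -> : x * (normal_peak 1 * (x ^+ 2 / 2)^-1) = normal_peak 1 * 2 / x.
  by field; rewrite gt_eqF.
by rewrite ltr_pdivrMr// -ltr_pdivrMl// mulrC.
Unshelve. all: by end_near. Qed.

Let derivable_G (x : R) : derivable G x 1.
Proof. by case: (is_derive_G x). Qed.

Let continuous_G : continuous G.
Proof. by move=> x; exact/differentiable_continuous/derivable1_diffP. Qed.

Let G'E x : G^`()%classic x = (1 - x ^+ 2) * phi x.
Proof. by rewrite derive1E; case: (is_derive_G x). Qed.

Let continuous_sqr : continuous (fun x : R => x ^+ 2).
Proof. exact: exprn_continuous. Qed.

Let continuous_G' : continuous ((fun x => (1 - x ^+ 2) * phi x) : R -> R).
Proof.
move=> x; apply: cvgM; last exact: continuous_phi.
by apply: cvgB; [exact: cvg_cst|exact: continuous_sqr].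
Qed.

Let mE (f : R -> R) (D : set R) : measurable D -> continuous f ->
  measurable_fun D (EFin \o f).
Proof.
move=> mD cf; apply/measurable_EFinP/measurable_funTS.
exact: continuous_measurable_fun.
Qed.

(** The half-line is cut at 1, where [1 - x ^+ 2] changes sign, so that only nonnegative functions
    are integrated. The boundary term [phi 1] appears on opposite sides in the two pieces and
    cancels. *)
Let int01 : (\int[mu]_(x in `[0%R, 1%R]) (phi x)%:E =
  \int[mu]_(x in `[0%R, 1%R]) (x ^+ 2 * phi x)%:E + (phi 1)%:E)%E.
Proof.
have -> : (phi 1)%:E = (\int[mu]_(x in `[0%R, 1%R]) ((1 - x ^+ 2) * phi x)%:E)%E.
  rewrite (continuous_FTC2 (F := G))//.
  - by rewrite /G mul1r mul0r sube0.
  - exact: continuous_subspaceT.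
  - split => //; first by apply: cvg_at_right_filter; exact: continuous_G.
    by apply: cvg_at_left_filter; exact: continuous_G.
rewrite -ge0_integralD//.
- by apply: eq_integral => x _; rewrite -EFinD; congr EFin; ring.
- by move=> x _; rewrite lee_fin mulr_ge0// sqr_ge0.
- apply: mE => // x; apply: cvgM; [exact: continuous_sqr|exact: continuous_phi].
- move=> x /=; rewrite in_itv/= => /andP[x0 x1].
  by rewrite lee_fin mulr_ge0// subr_ge0 expr_le1.
- exact: mE.
Qed.

Let int1y : (\int[mu]_(x in `[1%R, +oo[) (x ^+ 2 * phi x)%:E =
  \int[mu]_(x in `[1%R, +oo[) (phi x)%:E + (phi 1)%:E)%E.
Proof.
have -> : (phi 1)%:E = (\int[mu]_(x in `[1%R, +oo[) ((x ^+ 2 - 1) * phi x)%:E)%E.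
  rewrite (@ge0_continuous_FTC2y _ _ (fun x => - G x) 1 0)//.
  - by rewrite /G mul1r EFinN oppeK add0e.
  - by move=> x x1; rewrite mulr_ge0// subr_ge0 expr_ge1// (le_trans ler01).
  - apply: continuous_subspaceT => x; apply: cvgM; last exact: continuous_phi.
    by apply: cvgB; [exact: continuous_sqr|exact: cvg_cst].
  - by rewrite -oppr0; exact: cvgN.
  - by move=> x _; apply: derivableN.
  - by apply: cvg_at_right_filter; apply: cvgN; exact: continuous_G.
  - move=> x _; rewrite derive1N// G'E; ring.
rewrite -ge0_integralD//.
- by apply: eq_integral => x _; rewrite -EFinD; congr EFin; ring.
- by move=> x _; rewrite lee_fin.
- exact: mE.
- move=> x /=; rewrite in_itv/= andbT => x1.
  by rewrite lee_fin mulr_ge0// subr_ge0 expr_ge1// (le_trans ler01).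
- apply: mE => // x; apply: cvgM; last exact: continuous_phi.
  by apply: cvgB; [exact: continuous_sqr|exact: cvg_cst].
Qed.

Let split0y (f : R -> R) : (forall x, 0 <= f x) -> continuous f ->
  (\int[mu]_(x in [set x | (0 <= x)%R]) (f x)%:E =
   \int[mu]_(x in `[0%R, 1%R]) (f x)%:E + \int[mu]_(x in `[1%R, +oo[) (f x)%:E)%E.
Proof.
move=> f0 cf; rewrite -(integral_itv_obnd_cbnd (r := 1)); last exact: mE.
rewrite -ge0_integral_setU//.
- congr integral; apply/seteqP; split => x /=; rewrite !in_itv/= !andbT.
    by move=> x0; case: (leP x 1) => x1; [left; rewrite x0|right].
  by move=> [/andP[]//|/ltW]; exact: le_trans.
- by apply: mE => //; exact: measurableU.
- by move=> x _; rewrite lee_fin.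
- rewrite disj_set2E; apply/eqP/seteqP; split => // x [/=].
  by rewrite !in_itv/= andbT => /andP[_ x1]; rewrite ltNge x1.
Qed.

Lemma normal_second_moment : (\int[N01]_x (x ^+ 2)%:E = 1)%E.
Proof.
rewrite integral_N01; last 2 first.
- by apply/measurable_EFinP; exact: measurable_funX.
- by move=> x; rewrite lee_fin sqr_ge0.
rewrite -/phi -(integral_normal_pdf 0 1) -/phi.
rewrite (@ge0_symfun_integralT _ (fun x => x ^+ 2 * phi x)); last 3 first.
- by move=> x; rewrite mulr_ge0// sqr_ge0.
- by move=> x; apply: cvgM; [exact: continuous_sqr|exact: continuous_phi].
- by move=> x /=; rewrite !phiE sqrrN.
rewrite (@ge0_symfun_integralT _ phi)//; last by move=> x /=; rewrite !phiE sqrrN.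
congr (_ * _)%E; rewrite !split0y//; last 2 first.
- by move=> x; rewrite mulr_ge0// sqr_ge0.
- by move=> x; apply: cvgM; [exact: continuous_sqr|exact: continuous_phi].
by rewrite int01 int1y -addeA; congr (_ + _)%E; rewrite addeC.
Qed.

End normal_moments.

(** * Integrals of functions of identically distributed variables *)

Section same_law.
Local Open Scope ereal_scope.
Context d1 d2 d3 (T1 : measurableType d1) (T2 : measurableType d2)
  (Y : measurableType d3) (R : realType).
Variables (mu1 : {measure set T1 -> \bar R}) (mu2 : {measure set T2 -> \bar R}).
Variables (X1 : T1 -> Y) (X2 : T2 -> Y).
Hypotheses (mX1 : measurable_fun setT X1) (mX2 : measurable_fun setT X2).
Hypothesis same_law : forall B, measurable B ->
  mu1 (X1 @^-1` B) = mu2 (X2 @^-1` B).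

Lemma ge0_same_law_integral (f : Y -> \bar R) :
  measurable_fun setT f -> (forall y, 0 <= f y) ->
  \int[mu1]_x f (X1 x) = \int[mu2]_x f (X2 x).
Proof.
move=> mf f0.
transitivity (\int[pushforward mu1 X1]_y f y).
  by rewrite ge0_integral_pushforward.
transitivity (\int[pushforward mu2 X2]_y f y); last first.
  by rewrite ge0_integral_pushforward.
apply: (eq_measure_integral
  (image_measure mu2 mX2)).
by move=> A mA _; exact: same_law.
Qed.

(** The integrals of the positive and of the negative part agree separately, so the identity holds
    whatever the value of their difference. *)
Lemma same_law_integral (f : Y -> \bar R) : measurable_fun setT f ->
  \int[mu1]_x f (X1 x) = \int[mu2]_x f (X2 x).
Proof.
move=> mf; rewrite [LHS]integralE [RHS]integralE.
rewrite -[(fun x => f (X1 x))]/(f \o X1).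
rewrite -[(fun x => f (X2 x))]/(f \o X2).
rewrite (funepos_comp f X1) (funeneg_comp f X1) (funepos_comp f X2).
rewrite (funeneg_comp f X2).
congr (_ - _); apply: ge0_same_law_integral.
- exact: measurable_funepos.
- by move=> y; exact: funepos_ge0.
- exact: measurable_funeneg.
- by move=> y; exact: funeneg_ge0.
Qed.

End same_law.

(** * Mean and variance of Gaussian variables *)

Section gaussian_moments.
Variable R : realType.
Notation N01 := (normal_prob (0 : R) 1).
Local Open Scope ereal_scope.

Lemma integrable_sqr_Lfun2 d (T : measurableType d) (P : probability T R)
    (X : T -> R) : measurable_fun setT X ->
  \int[P]_x (X x ^+ 2)%:E < +oo -> X \in Lfun P 2%:E.
Proof.
move=> mX Xoo; rewrite inE/=; apply/andP; split.
  by rewrite inE.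
rewrite inE/= /finite_norm unlock /Lnorm.
apply: poweR_lty.
under eq_integral do rewrite abse_EFin poweR_EFin powR_mulrn// real_normK ?num_real//.
done.
Qed.

Lemma Lfun2_Lfun1 d (T : measurableType d) (P : probability T R) (X : T -> R) :
  X \in Lfun P 2%:E -> X \in Lfun P 1.
Proof. by apply: Lfun_subset12; exact: fin_num_measure. Qed.

Lemma affine_Lfun2 d (T : measurableType d) (P : probability T R) (X : T -> R)
    (m s : R) :
  X \in Lfun P 2%:E -> (fun x => m + s * X x)%R \in Lfun P 2%:E.
Proof.
move=> X2.
rewrite (_ : (fun x => _) = (cst m \+ (s \o* X))%R); last first.
  by apply/funext => z /=; rewrite mulrC.
rewrite rpredD//=; first by rewrite lee1n.
  by move=> _; exact: Lfun_cst.
by move=> _; apply: Lfun_scale => //; rewrite ler1n.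
Qed.

Lemma affine_mean d (T : measurableType d) (P : probability T R) (X : T -> R)
    (m s : R) : X \in Lfun P 2%:E ->
  'E_P[(fun x => m + s * X x)%R] = m%:E + s%:E * 'E_P[X].
Proof.
move=> /Lfun2_Lfun1 X1.
rewrite (_ : (fun x => _) = (cst m \+ (s \o* X))%R); last first.
  by apply/funext => z /=; rewrite mulrC.
rewrite expectationD ?Lfun_cst ?Lfun_scale//.
by rewrite expectation_cst expectationZl.
Qed.

Let id01 : (@id R : measurableTypeR R -> R) \in Lfun N01 2%:E.
Proof.
apply: integrable_sqr_Lfun2 => //.
by rewrite normal_second_moment ltry.
Qed.

(** Symmetry, from [gauss_law_sqr] with scales 1 and -1, makes the mean its own opposite; square
    integrability makes it finite, hence zero. *)
Let mean01 : 'E_N01[@id R] = 0.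
Proof.
have same B : measurable B -> N01 (id @^-1` B) = N01 ((fun z : R => - z)%R @^-1` B).
  move=> mB; have := @gauss_law_sqr R 0 1 (-1) B; rewrite sqrrN => /(_ erefl mB).
  rewrite /gauss_law; congr (N01 _ = N01 _); apply/seteqP; split => z /=;
   by rewrite add0r ?mulN1r ?mul1r.
have mN : measurable_fun setT
    (fun z : measurableTypeR R => (- z)%R : measurableTypeR R).
  exact: measurable_funN.
have := same_law_integral (mu1 := N01) (mu2 := N01) (f := EFin)
  (@measurable_id _ (measurableTypeR R) setT) mN same.
have mE : measurable_fun [set: measurableTypeR R] (@EFin R) by [].
move=> /(_ mE) E1.
have E2 : 'E_N01[@id R] = - 'E_N01[@id R].
  rewrite -[RHS]mulN1e -expectationZl ?Lfun2_Lfun1// unlock.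
  rewrite [LHS]E1; apply: eq_integral => x _.
  by rewrite /= mulrN1.
have := expectation_fin_num (Lfun2_Lfun1 id01).
move: E2; case: ('E_N01[@id R]) => // r [rN] _.
by congr EFin; lra.
Qed.

Context d (T : measurableType d) (P : probability T R) (X : T -> R) (m s : R).
Hypothesis mX : measurable_fun setT X.
Hypothesis gaussX : forall B : set (measurableTypeR R), measurable B ->
  P (X @^-1` B) = gauss_law m s B.

Let gauss_integral (f : R -> \bar R) :
  measurable_fun [set: measurableTypeR R] f ->
  \int[P]_x f (X x) = \int[N01]_z f (m + s * z)%R.
Proof.
by apply: (same_law_integral (X1 := X : T -> measurableTypeR R) mX
  (measurable_affine m s) gaussX).
Qed.

Let affine01_Lfun2 : (fun z => m + s * z)%R \in Lfun N01 2%:E.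
Proof. exact: affine_Lfun2. Qed.

(** Gaussianity only asserts that some [m] and [s] exist. Square integrability makes moments
    available, and [gauss_mean] and [gauss_variance] then identify [m] and [s ^+ 2]. *)
Lemma gauss_Lfun2 : X \in Lfun P 2%:E.
Proof.
apply: integrable_sqr_Lfun2 => //.
rewrite (gauss_integral (f := fun x => (x ^+ 2)%:E)); last first.
  by apply/measurable_EFinP; exact: measurable_funX.
have /Lfun2_integrable_sqr/integrableP[_] := affine01_Lfun2.
by under eq_integral do rewrite /= ger0_norm ?sqr_ge0//.
Qed.

Lemma gauss_mean : 'E_P[X] = m%:E.
Proof.
rewrite unlock (gauss_integral (f := EFin))//.
transitivity ('E_N01[(fun z => m + s * z)%R]); first by rewrite unlock.
by rewrite (affine_mean _ _ id01) mean01 mule0 adde0.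
Qed.

Lemma gauss_variance : covariance P X X = (s ^+ 2)%:E.
Proof.
rewrite unlock gauss_mean/= unlock.
rewrite (gauss_integral (f := fun x => ((x - m) * (x - m))%:E)); last first.
  by apply/measurable_EFinP; apply: measurable_funM; exact: measurable_funB.
rewrite -[RHS]mule1 -normal_second_moment -ge0_integralZl//.
- by apply: eq_integral => z _; rewrite -EFinM addrAC subrr add0r -expr2 exprMn.
- by apply/measurable_EFinP; exact: measurable_funX.
- by move=> z _; rewrite lee_fin sqr_ge0.
- by rewrite lee_fin sqr_ge0.
Qed.

End gaussian_moments.

Lemma is_gaussian_law (R : realType) d (T : measurableType d)
    (P : probability T R) (X : T -> R) : is_gaussian P X ->
  exists m s : R, forall B : set (measurableTypeR R), measurable B ->
    P (X @^-1` B) = gauss_law m s B.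
Proof.
move=> [m [s [_ XP]]]; exists m, s => B mB; rewrite XP//.
by case: eqVneq => [->|s0]; rewrite ?gauss_law_dirac// gauss_law_normal.
Qed.

(** * Linear forms under a product of normal laws *)

Section normal_projection.
Variable R : realType.
Notation N01 := (normal_prob (0 : R) 1).

Lemma measurable_gauss_law (t : R) (B : set (measurableTypeR R)) :
  measurable B ->
  measurable_fun [set: measurableTypeR R] (fun x => gauss_law x t B).
Proof.
move=> mB.
pose A : set (measurableTypeR R * measurableTypeR R) :=
  [set z | B (z.1 + t * z.2)].
have mA : measurable A.
  rewrite -[A]setTI.
  have mf : measurable_fun [set: measurableTypeR R * measurableTypeR R]
      ((fun z => z.1 + t * z.2) : _ -> measurableTypeR R).
    apply: measurable_funD; first exact: measurable_fst.
    by apply: measurable_funM => //; exact: measurable_snd.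
  exact: mf.
have -> : (fun x => gauss_law x t B) = N01 \o xsection A.
  apply/funext => x; rewrite /gauss_law /=; congr (normal_prob 0 1 _).
  by apply/seteqP; split => z /=; rewrite /xsection /= inE.
exact: measurable_fun_xsection.
Qed.

Lemma measurable_linear_form n (a : 'I_n -> R) :
  measurable_fun [set: 'rV[R]_n]
    ((fun x => \sum_(k < n) a k * x 0 k) : 'rV[R]_n -> measurableTypeR R).
Proof.
apply: measurable_sum => k; apply: measurable_funM => //.
exact: measurable_row_coord.
Qed.

(** Induction on the dimension: for a fixed first coordinate the remaining ones give a normal law
    with shifted mean, and [gauss_law_conv] integrates the first coordinate out. *)
Lemma normal_product_proj n (m a : 'I_n -> R) (B : set (measurableTypeR R)) :
  measurable B ->
  product_probability (fun k => normal_prob (m k) 1)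
    [set x | B (\sum_(k < n) a k * x 0 k)] =
  gauss_law (\sum_(k < n) a k * m k) (Num.sqrt (\sum_(k < n) a k ^+ 2)) B.
Proof.
elim: n m a B => [|n IH] m a B mB.
  rewrite !big_ord0 sqrtr0 gauss_law_dirac /= diracE diracE.
  by congr ((nat_of_bool _)%:R)%:E; apply/idP/idP; rewrite !inE /= big_ord0.
have cons_sumE x (y : 'rV[R]_n) : \sum_(k < n.+1) a k * cons_row (x, y) 0 k =
    a ord0 * x + \sum_(k < n) a (lift ord0 k) * y 0 k.
  rewrite big_ord_recl mxE unlift_none /=; congr (_ + _).
  by apply: eq_bigr => k _; rewrite mxE liftK.
set Q := product_probability (fun k => normal_prob (m (lift ord0 k)) 1).
transitivity (\int[normal_prob (m ord0) 1]_x
    gauss_law (a ord0 * x + \sum_(k < n) a (lift ord0 k) * m (lift ord0 k))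
     (Num.sqrt (\sum_(k < n) a (lift ord0 k) ^+ 2)) B)%E.
  rewrite [LHS]/= /distribution /pushforward /product_measure1.
  apply: eq_integral => x _ /=.
  pose B' : set (measurableTypeR R) := [set t | B (a ord0 * x + t)].
  have mB' : measurable B'.
    rewrite -[B']setTI; apply: (_ : measurable_fun setT
     ((fun t => a ord0 * x + t) : measurableTypeR R -> measurableTypeR R)) => //.
    exact: measurable_funD.
  transitivity (Q [set y | B' (\sum_(k < n) a (lift ord0 k) * y 0 k)]).
    congr (Q _); apply/seteqP.
    by split => y; rewrite /xsection /= inE /= cons_sumE.
  rewrite /Q IH// /gauss_law; congr (normal_prob 0 1 _).
  by apply/seteqP; split => z; rewrite /B' /= addrA.
rewrite !big_ord_recl addrC.
set m' := \sum_(k < n) _; set s' := Num.sqrt _.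
have mX1 : measurable_fun [set: measurableTypeR R]
   (fun x => gauss_law (a ord0 * x + m') s' B).
  apply: (measurableT_comp (measurable_gauss_law s' mB)).
  by apply: measurable_funD => //; exact: measurable_funM.
(* The first coordinate is written as [m ord0 + z] with [z] of law [N01], the form that
   [gauss_law_conv] requires. *)
have same A : measurable A -> normal_prob (m ord0) 1 (id @^-1` A) =
    N01 ((fun z => m ord0 + 1 * z) @^-1` A).
  by move=> mA; rewrite -normal_prob_affine// ?oner_neq0.
rewrite (ge0_same_law_integral (X1 := @id (measurableTypeR R))
  (X2 := (fun z => m ord0 + 1 * z) : measurableTypeR R -> measurableTypeR R)
  (@measurable_id _ _ setT) (measurable_affine _ _) same mX1); last first.
  by move=> x; exact: measure_ge0.
have -> : a ord0 ^+ 2 + \sum_(i < n) a (lift ord0 i) ^+ 2 = a ord0 ^+ 2 + s' ^+ 2.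
  by rewrite sqr_sqrtr// sumr_ge0// => k _; rewrite sqr_ge0.
rewrite -gauss_law_conv//; apply: eq_integral => z _.
have E (t : R) : a ord0 * (m ord0 + 1 * t) + m' =
    m' + a ord0 * m ord0 + a ord0 * t by ring.
exact: (congr1 (fun u => gauss_law u s' B) (E z)).
Qed.

End normal_projection.

(** * Laws on R^n are determined by their projections *)

Section step_approximation.
Variable R : realType.
Implicit Types t u : R.

(* A polynomial in [t] tending boundedly to the indicator of [0 < t] on [-1, 1];
   the second factor forces the value [0] at [t = 0]. *)
Definition step_approx (n : nat) (t : R) : R :=
  (1 - (1 - ((1 + t) / 2) ^+ n) ^+ (2 ^ n)) * (1 - (1 - t ^+ 2) ^+ n).

Lemma bernoulli_le (x : R) n : -1 <= x -> 1 + n%:R * x <= (1 + x) ^+ n.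
Proof.
move=> x1; elim: n => [|n IH]; first by rewrite mul0r addr0 expr0.
have x10 : 0 <= 1 + x by lra.
rewrite exprS; apply: le_trans (ler_wpM2l x10 IH).
have : 0 <= n%:R * x ^+ 2 by rewrite mulr_ge0 ?sqr_ge0.
by rewrite -natr1; lra.
Qed.

(** Bernoulli gives [N%:R * u <= (1 + u) ^+ N], while [(1 - u) * (1 + u) <= 1]. *)
Lemma expr_1B_le_inv u N : 0 < u <= 1 -> (0 < N)%N ->
  (1 - u) ^+ N <= (N%:R * u)^-1.
Proof.
move=> /andP[u0 u1] N0.
have Nu0 : 0 < N%:R * u by rewrite mulr_gt0// ltr0n.
rewrite -[leRHS]mul1r ler_pdivlMr//.
have h : N%:R * u <= (1 + u) ^+ N.
  apply: le_trans (bernoulli_le _ _); [by rewrite lerDr|by lra].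
apply: (@le_trans _ _ ((1 - u) ^+ N * (1 + u) ^+ N)).
  by rewrite ler_wpM2l// exprn_ge0//; lra.
rewrite -exprMn; apply: exprn_ile1.
  by rewrite mulr_ge0//; lra.
by have := sqr_ge0 u; lra.
Qed.

Lemma step_approx_bound n t : -1 <= t <= 1 -> 0 <= step_approx n t <= 1.
Proof.
move=> /andP[t0 t1].
have s01 : 0 <= 1 - ((1 + t) / 2) ^+ n <= 1.
  have : 0 <= ((1 + t) / 2) ^+ n <= 1.
    by rewrite exprn_ge0 ?exprn_ile1//=; lra.
  by lra.
have A : 0 <= (1 - ((1 + t) / 2) ^+ n) ^+ (2 ^ n) <= 1.
  by case/andP: s01 => ? ?; rewrite exprn_ge0 ?exprn_ile1.
have t2 : 0 <= 1 - t ^+ 2 <= 1 by have := sqr_ge0 t; nra.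
have B : 0 <= (1 - t ^+ 2) ^+ n <= 1.
  by case/andP: t2 => ? ?; rewrite exprn_ge0 ?exprn_ile1.
by rewrite /step_approx mulr_ge0 ?mulr_ile1//; lra.
Qed.

(** The exponents are tuned so that [2 ^ n] times [((1 + t) / 2) ^+ n] is [(1 + t) ^+ n]. With [u]
    the latter power of [(1 + t) / 2], [(1 - u) ^+ (2 ^ n)] differs from 1 by at most [(1 + t) ^+ n]
    if [t < 0], and is at most the inverse of [(1 + t) ^+ n] if [0 < t]. *)
Lemma cvg_step_approx t : -1 <= t <= 1 ->
  step_approx ^~ t @ \oo --> ((0 < t)%R%:R : R).
Proof.
move=> /andP[tm1 t1].
have [t0|t0|->] := ltrgt0P t; last first.
- rewrite /step_approx; under eq_fun do rewrite expr0n/= subr0 expr1n subrr mulr0.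
  exact: cvg_cst.
- have lim0 : (1 + t) ^+ n @[n --> \oo] --> (0 : R).
    by apply: cvg_expr; rewrite ger0_norm//; lra.
  apply: (squeeze_cvgr _ (cvg_cst 0) lim0); apply: nearW => n.
  have /andP[-> _] : 0 <= step_approx n t <= 1 by apply: step_approx_bound; lra.
  have u01 : 0 <= ((1 + t) / 2) ^+ n <= 1.
    by rewrite exprn_ge0 ?exprn_ile1//=; lra.
  have A : 1 - (1 - ((1 + t) / 2) ^+ n) ^+ (2 ^ n) <= (1 + t) ^+ n.
    have /(bernoulli_le (2 ^ n)) : -1 <= - ((1 + t) / 2) ^+ n by lra.
    have -> : (1 + t) ^+ n = (2 ^ n)%:R * ((1 + t) / 2) ^+ n.
      by rewrite natrX -exprMn; congr (_ ^+ _); field.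
    by lra.
  have A0 : 0 <= (1 - ((1 + t) / 2) ^+ n) ^+ (2 ^ n) <= 1.
    by rewrite exprn_ge0 ?exprn_ile1//=; lra.
  have t2 : 0 <= 1 - t ^+ 2 <= 1 by have := sqr_ge0 t; nra.
  have B : 0 <= (1 - t ^+ 2) ^+ n <= 1.
    by case/andP: t2 => ? ?; rewrite exprn_ge0 ?exprn_ile1.
  by rewrite /=; apply: le_trans A; rewrite /step_approx ler_piMr//; lra.
- have lim0 : ((1 + t)^-1) ^+ n @[n --> \oo] --> (0 : R).
    apply: cvg_expr; rewrite ger0_norm ?invr_ge0; last by lra.
    by rewrite invf_lt1; lra.
  have limA : (1 - ((1 + t) / 2) ^+ n) ^+ (2 ^ n) @[n --> \oo] --> (0 : R).
    apply: (squeeze_cvgr _ (cvg_cst 0) lim0); apply: nearW => n.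
    have u01 : 0 < ((1 + t) / 2) ^+ n <= 1.
      by rewrite exprn_gt0 ?exprn_ile1//=; lra.
    rewrite exprn_ge0/=; last by lra.
    apply: le_trans (expr_1B_le_inv u01 _) _; first by rewrite expn_gt0.
    rewrite natrX -exprMn exprVn.
    by rewrite (_ : 2 * ((1 + t) / 2) = 1 + t); last by field.
  have limB : (1 - t ^+ 2) ^+ n @[n --> \oo] --> (0 : R).
    by apply: cvg_expr; rewrite ger0_norm; nra.
  rewrite [X in _ --> X](_ : _ = (1 - 0) * (1 - 0)); last by rewrite !subr0 mulr1.
  by apply: cvgM; apply: cvgB => //; exact: cvg_cst.
Qed.

End step_approximation.

Section cramer_wold.
Variables (R : realType) (n : nat).
Implicit Types (f g : 'rV[R]_n -> R) (a : 'I_n -> R).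

(* Every member has an expectation determined by the laws of the linear forms;
   the class is closed under products and contains all Borel indicators. *)
Inductive trig_closure : ('rV[R]_n -> R) -> Prop :=
| trig_cos a b : trig_closure (fun y => cos (\sum_(k < n) a k * y 0 k + b))
| trig_lin c f g : trig_closure f -> trig_closure g ->
    trig_closure (fun y => c * f y + g y)
| trig_lim (u : nat -> 'rV[R]_n -> R) f M : (forall i, trig_closure (u i)) ->
    (forall i y, `|u i y| <= M) -> (forall y, u i y @[i --> \oo] --> f y) ->
    trig_closure f.

Lemma cos_le1_norm (x : R) : `|cos x| <= 1.
Proof. by rewrite ler_norml cos_geN1 cos_le1. Qed.

(** The bound is needed to multiply a bounded limit by a fixed member of the class, and for
    integrability. *)
Lemma trig_bounded f : trig_closure f -> exists M, forall y, `|f y| <= M.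
Proof.
elim=> [a b|c {}f g _ [M fM] _ [N gN]|u {}f M _ _ uM uf].
- by exists 1 => y; exact: cos_le1_norm.
- exists (`|c| * M + N) => y; apply: (le_trans (ler_normD _ _)).
  by rewrite lerD// normrM ler_wpM2l.
- exists M => y.
  have /cvg_norm uy := uf y.
  rewrite -(cvg_lim (@norm_hausdorff _ _) uy).
  apply: limr_le; first by apply/cvg_ex; eexists; exact: uy.
  by apply: nearW => i; exact: uM.
Qed.

Lemma trig_ext f g : f =1 g -> trig_closure f -> trig_closure g.
Proof. by move=> /funext ->. Qed.

Lemma trig_cst c : trig_closure (cst c).
Proof.
apply: (@trig_ext (fun y => (c - 1) * cos (\sum_(k < n) 0 * y 0 k + 0) +
    cos (\sum_(k < n) 0 * y 0 k + 0))).
  move=> y; rewrite big1 ?addr0 ?cos0/=; last by move=> *; rewrite mul0r.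
  by ring.
by apply: trig_lin; exact: trig_cos.
Qed.

Lemma trigD f g : trig_closure f -> trig_closure g ->
  trig_closure (fun y => f y + g y).
Proof.
move=> tf tg; apply: (trig_ext _ (trig_lin 1 tf tg)) => y; by rewrite mul1r.
Qed.

Lemma trigZ c f : trig_closure f -> trig_closure (fun y => c * f y).
Proof.
move=> tf; apply: (trig_ext _ (trig_lin c tf (trig_cst 0))) => y.
by rewrite addr0.
Qed.

Lemma trigB f g : trig_closure f -> trig_closure g ->
  trig_closure (fun y => f y - g y).
Proof.
move=> tf tg; apply: (trig_ext _ (trig_lin (-1) tg tf)) => y.
by rewrite mulN1r addrC.
Qed.

(** Induction on both factors. Two cosines are handled by the product-to-sum formula; linear
    combinations and bounded limits pass through multiplication by a bounded factor. *)
Lemma trigM f g : trig_closure f -> trig_closure g ->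
  trig_closure (fun y => f y * g y).
Proof.
move=> tf; elim: tf g => [a b|c {}f h _ IHf _ IHh|u {}f M _ IHu uM uf] g tg.
- elim: tg => [a' b'|c {}f {}g _ IHf _ IHg|u {}f M _ IHu uM uf].
  + apply: (@trig_ext (fun y =>
       2^-1 * cos (\sum_(k < n) (a k + a' k) * y 0 k + (b + b')) +
       2^-1 * cos (\sum_(k < n) (a k - a' k) * y 0 k + (b - b')))).
      move=> y.
      under eq_bigr do rewrite mulrDl; rewrite big_split/=.
      under [X in _ + 2^-1 * cos (X + _)]eq_bigr do rewrite mulrBl.
      rewrite sumrB; set A := \sum_(_ < _) _; set A' := \sum_(_ < _) _.
      rewrite (_ : A + A' + (b + b') = (A + b) + (A' + b')); last by ring.
      rewrite (_ : A - A' + (b - b') = (A + b) - (A' + b')); last by ring.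
      by rewrite cosD cosB; field.
    by apply: trigD; apply: trigZ; exact: trig_cos.
  + apply: (trig_ext _ (trig_lin c IHf IHg)) => y; ring.
  + apply: (@trig_lim (fun i y => cos (\sum_(k < n) a k * y 0 k + b) * u i y) _ M).
    * exact: IHu.
    * move=> i y; rewrite normrM -[leRHS]mul1r ler_pM//.
      exact: cos_le1_norm.
    * by move=> y; apply: cvgM => //; exact: cvg_cst.
- by apply: (trig_ext _ (trig_lin c (IHf _ tg) (IHh _ tg))) => y; ring.
- have [N gN] := trig_bounded tg.
  apply: (@trig_lim (fun i y => u i y * g y) _ (M * N)).
  + by move=> i; exact: IHu.
  + by move=> i y; rewrite normrM ler_pM.
  + by move=> y; apply: cvgM => //; exact: cvg_cst.
Qed.

Lemma trigX f i : trig_closure f -> trig_closure (fun y => f y ^+ i).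
Proof.
move=> tf; elim: i => [|i IH].
  by apply: (trig_ext _ (trig_cst 1)) => y; rewrite expr0.
by apply: (trig_ext _ (trigM tf IH)) => y; rewrite exprS.
Qed.

(** [step_approx i] is a polynomial, so composing it with [f] stays in the class; the bound on [f]
    keeps the argument where the approximation converges boundedly. *)
Lemma trig_pos f : trig_closure f -> (forall y, `|f y| <= 1) ->
  trig_closure (\1_[set y | 0 < f y]).
Proof.
move=> tf f1.
have f11 y : -1 <= f y <= 1 by rewrite -ler_norml.
apply: (@trig_lim (fun i y => step_approx i (f y)) _ 1).
- move=> i; apply: trigM.
    apply: trigB; first exact: trig_cst.
    apply/trigX/trigB; first exact: trig_cst.
    apply: trigX; apply: (@trig_ext (fun y => 2^-1 * (cst 1 y + f y))).
      by move=> y; rewrite mulrC.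
    by apply: trigZ; apply: trigD => //; exact: trig_cst.
  apply: trigB; first exact: trig_cst.
  by apply/trigX/trigB; [exact: trig_cst|exact: trigX].
- by move=> i y; have := step_approx_bound i (f11 y); rewrite ler_norml; lra.
- move=> y; rewrite indicE.
  rewrite (_ : (y \in _) = (0 < f y)); first exact: cvg_step_approx.
  by apply/idP/idP; rewrite inE.
Qed.

(* For large [i], [sin ((y_k - c) / i)] has the sign of [y_k - c]. *)
Lemma trig_halfspace (k : 'I_n) (c : R) :
  trig_closure (\1_[set y : 'rV[R]_n | c < y 0 k]).
Proof.
pose s (i : nat) (y : 'rV[R]_n) := sin ((y 0 k - c) / i.+1%:R).
have ts i : trig_closure (s i).
  apply: (@trig_ext (fun y => cos (\sum_(l < n) ((l == k)%:R / i.+1%:R) * y 0 l +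
     (- c / i.+1%:R - pi / 2)))); last exact: trig_cos.
  move=> y; rewrite (bigD1 k)//= eqxx big1 ?addr0; last first.
    by move=> l /negbTE ->; rewrite !mul0r.
  rewrite /s -cosBpihalf; congr cos; rewrite mulrBl !addrA; congr (_ - _).
  by rewrite mul1r mulNr mulrC.
apply: (@trig_lim (fun i => \1_[set y | 0 < s i y]) _ 1).
- move=> i; apply: trig_pos => // y.
  by rewrite ler_norml sin_geN1 sin_le1.
- by move=> i y; rewrite indicE; case: (_ \in _); rewrite ?normr1 ?normr0.
- move=> y; apply: cvg_near_cst; near=> i.
  rewrite !indicE; congr ((nat_of_bool _)%:R).
  have i0 : 0 < i.+1%:R :> R by rewrite ltr0n.
  have small : `|y 0 k - c| / i.+1%:R < pi.
    rewrite ltr_pdivrMr// mulrC -ltr_pdivrMr ?pi_gt0//.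
    rewrite -natr1 ltr_wpDr//; near: i; exact: nbhs_infty_gtr.
  have [yc|yc|yc] := ltrgtP (y 0 k) c.
  + apply/idP/idP; rewrite !inE/=; last by rewrite ltNge ltW.
    rewrite /s -[X in sin X]opprK sinN oppr_gt0 => h; exfalso; move: h.
    apply/negP; rewrite -leNgt ltW// sin_gt0_pi// -mulNr divr_gt0//=; last lra.
    by move: small; rewrite ltr0_norm//; lra.
  + apply/idP/idP; rewrite !inE/= => // _.
    rewrite sin_gt0_pi// divr_gt0//=; last lra.
    by move: small; rewrite gtr0_norm//; lra.
  + by apply/idP/idP; rewrite !inE/= /s yc subrr mul0r sin0 !ltxx.
Unshelve. all: by end_near. Qed.

Lemma trig_setC (E : set 'rV[R]_n) : trig_closure \1_E -> trig_closure \1_(~` E).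
Proof.
move=> tE; apply: (trig_ext _ (trigB (trig_cst 1) tE)) => y.
by rewrite !indicE in_setC; case: (_ \in _); rewrite /= ?subr0 ?subrr.
Qed.

Lemma trig_setI (E F : set 'rV[R]_n) : trig_closure \1_E -> trig_closure \1_F ->
  trig_closure \1_(E `&` F).
Proof.
move=> tE tF; apply: (trig_ext _ (trigM tE tF)) => y.
by rewrite indicI.
Qed.

Lemma trig_setU (E F : set 'rV[R]_n) : trig_closure \1_E -> trig_closure \1_F ->
  trig_closure \1_(E `|` F).
Proof.
move=> tE tF; rewrite -[E `|` F]setCK setCU.
by apply/trig_setC/trig_setI; exact: trig_setC.
Qed.

Lemma trig_set0 : trig_closure \1_(set0 : set 'rV[R]_n).
Proof. by apply: (trig_ext _ (trig_cst 0)) => y; rewrite indic0. Qed.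

Lemma trig_bigcup (F : nat -> set 'rV[R]_n) :
  (forall i, trig_closure \1_(F i)) -> trig_closure \1_(\bigcup_i F i).
Proof.
move=> tF; apply: (@trig_lim (fun i => \1_(\big[setU/set0]_(j < i) F j)) _ 1).
- move=> i; elim/big_ind : _ => //; first exact: trig_set0.
  exact: trig_setU.
- by move=> i y; rewrite indicE; case: (_ \in _); rewrite ?normr1 ?normr0.
- move=> y; apply: cvg_near_cst.
  have [[j _ Fjy]|nF] := pselect ((\bigcup_i F i) y).
    near=> i; rewrite !indicE !mem_set//; first by exists j.
    rewrite -bigcup_mkord; exists j => //=; near: i; exact: nbhs_infty_gt.
  apply: nearW => i; rewrite !indicE !memNset//.
  by rewrite -bigcup_mkord => -[j _ Fjy]; apply: nF; exists j.
Unshelve. all: by end_near. Qed.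

Let sigma_algebra_trig : sigma_algebra setT [set E | trig_closure \1_E].
Proof.
split; first exact: trig_set0.
- by move=> A tA /=; rewrite setTD; exact: trig_setC.
- by move=> A tA; exact: trig_bigcup.
Qed.

(** Two sigma-algebra arguments: the product sigma-algebra is generated by Borel conditions on
    single coordinates, and the Borel sets by half-lines, which [trig_halfspace] covers. *)
Lemma trig_measurable (E : set 'rV[R]_n) : measurable E -> trig_closure \1_E.
Proof.
move: E; apply: smallest_sub; first exact: sigma_algebra_trig.
rewrite -bigcup_seq/=; apply: bigcup_sub => k _ B [C mC <-].
rewrite setTI /=; have {mC} : (RGenOInfty.G (R:=R)).-sigma.-measurable C.
  by rewrite -RGenOInfty.measurableE.
move: C.
apply: (@smallest_sub _ _ _ [set C | trig_closure \1_(row_coord k @^-1` C)]).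
  split => /=.
  - by rewrite preimage_set0; exact: trig_set0.
  - by move=> A tA; rewrite setTD preimage_setC; exact: trig_setC.
  - by move=> A tA; rewrite preimage_bigcup; exact: trig_bigcup.
move=> _ [c ->].
have E : row_coord k @^-1` `]c, +oo[%classic = [set y : 'rV[R]_n | c < y 0 k].
  by apply/seteqP; split => y; rewrite /row_coord /= in_itv/= andbT.
suff : trig_closure (\1_(row_coord k @^-1` `]c, +oo[%classic)) by [].
by rewrite E; exact: trig_halfspace.
Qed.

Lemma trig_measurable_fun f : trig_closure f -> measurable_fun setT f.
Proof.
elim=> [a b|c {}f g _ mf _ mg|u {}f M _ mu _ uf].
- apply: (measurableT_comp (continuous_measurable_fun (@continuous_cos R))).
  by apply: measurable_funD => //; exact: measurable_linear_form.
- by apply: measurable_funD => //; exact: measurable_funM.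
- by apply: (measurable_fun_cvg mu) => y _; exact: uf.
Qed.

Section equal_projections.
Context d1 d2 (T1 : measurableType d1) (T2 : measurableType d2).
Variables (P1 : probability T1 R) (P2 : probability T2 R).
Variables (X1 : T1 -> 'rV[R]_n) (X2 : T2 -> 'rV[R]_n).
Hypotheses (mX1 : measurable_fun setT X1) (mX2 : measurable_fun setT X2).
Hypothesis proj_law : forall a (B : set (measurableTypeR R)), measurable B ->
  P1 [set w | B (\sum_(k < n) a k * X1 w 0 k)] =
  P2 [set w | B (\sum_(k < n) a k * X2 w 0 k)].

Let integrable_bounded d (T : measurableType d) (P : probability T R)
    (X : T -> 'rV[R]_n) f : measurable_fun setT X -> trig_closure f ->
  P.-integrable setT (fun w => (f (X w))%:E).
Proof.
move=> mX tf; have [M fM] := trig_bounded tf.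
apply: (@le_integrable _ _ _ _ _ measurableT _ (EFin \o cst M)).
- apply/measurable_EFinP; exact: (measurableT_comp (trig_measurable_fun tf) mX).
- by move=> w _ /=; rewrite lee_fin (le_trans (fM _))// ler_norm.
- exact: finite_measure_integrable_cst.
Qed.

(** The hypothesis on projections enters only for a cosine, a function of one linear form. Linearity
    and dominated convergence with constant bound [M] do the rest. *)
Let trig_integral f : trig_closure f ->
  (\int[P1]_w (f (X1 w))%:E = \int[P2]_w (f (X2 w))%:E)%E.
Proof.
elim=> [a b|c {}f g tf IHf tg IHg|u {}f M tu IHu uM uf].
- have mlin := measurable_linear_form a.
  apply: (@same_law_integral _ _ _ _ _ _ _ P1 P2 _ _ (measurableT_comp mlin mX1)
    (measurableT_comp mlin mX2) (proj_law a) (fun x => (cos (x + b))%:E)).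
  apply/measurable_EFinP.
  apply: (measurableT_comp (continuous_measurable_fun (@continuous_cos R))).
  exact: measurable_funD.
- under eq_integral do rewrite EFinD EFinM.
  under [RHS]eq_integral do rewrite EFinD EFinM.
  rewrite !integralD//; try exact: integrable_bounded;
    try by apply: integrableZl => //; exact: integrable_bounded.
  by rewrite !integralZl ?IHf ?IHg//; exact: integrable_bounded.
- have lim d (T : measurableType d) (P : probability T R) (X : T -> 'rV[R]_n) :
    measurable_fun setT X ->
    (\int[P]_w (u i (X w))%:E @[i --> \oo] --> \int[P]_w (f (X w))%:E)%E.
    move=> mX.
    have tf : trig_closure f by exact: trig_lim uM uf.
    have m g : trig_closure g -> measurable_fun setT (fun w => (g (X w))%:E).
      move=> tg; apply/measurable_EFinP.
      exact: (measurableT_comp (trig_measurable_fun tg) mX).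
    have [| | |] := @dominated_convergence _ _ _ P _ measurableT
      (fun i w => (u i (X w))%:E) (fun w => (f (X w))%:E) (EFin \o cst M)
      (fun i => m _ (tu i)) (m _ tf) _ _ _.
    + by apply: aeW => w _; apply: cvg_EFin; [exact: nearW|exact: uf].
    + exact: finite_measure_integrable_cst.
    + by apply: aeW => w i _; rewrite /= lee_fin.
    + by [].
  have L1 := lim _ _ P1 _ mX1; have L2 := lim _ _ P2 _ mX2.
  rewrite (_ : (fun i => _) = (fun i => \int[P2]_w (u i (X2 w))%:E)%E) in L1.
    exact: (cvg_unique _ L1 L2).
  by apply/funext => i; exact: IHu.
Qed.

Lemma cramer_wold (E : set 'rV[R]_n) : measurable E ->
  P1 (X1 @^-1` E) = P2 (X2 @^-1` E).
Proof.
move=> mE; have := trig_integral (trig_measurable mE).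
have indE d (T : measurableType d) (P : probability T R) (X : T -> 'rV[R]_n) :
    measurable_fun setT X ->
    (\int[P]_w (\1_E (X w))%:E = P (X @^-1` E))%E.
  move=> mX; transitivity (\int[P]_w (\1_(X @^-1` E) w)%:E)%E.
    apply: eq_integral => w _; rewrite !indicE.
    by congr ((nat_of_bool _)%:R)%:E; apply/idP/idP; rewrite !inE.
  rewrite integral_indic// ?setIT//.
  by rewrite -[X in measurable X]setTI; exact: mX.
by rewrite !indE.
Qed.

End equal_projections.

End cramer_wold.

(** * Norms of Gaussian vectors *)

Section householder.
Variables (R : realType) (n : nat).
Implicit Types a x v : 'I_n -> R.

Definition dot a x : R := \sum_(k < n) a k * x k.

Lemma dotC a x : dot a x = dot x a.
Proof. by apply: eq_bigr => k _; rewrite mulrC. Qed.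

Lemma dotBr a x y c : dot a (fun k => x k - c * y k) = dot a x - c * dot a y.
Proof.
rewrite /dot mulr_sumr -sumrB; apply: eq_bigr => k _; ring.
Qed.

(* The reflection along [v]; the identity when [v = 0], since [x / 0 = 0]. *)
Definition reflection v x : 'I_n -> R :=
  fun k => x k - (2 * dot v x / dot v v) * v k.

Lemma reflection_adjoint v a x : dot (reflection v a) x = dot a (reflection v x).
Proof.
by rewrite dotC !dotBr (dotC x a) (dotC x v) (dotC a v); ring.
Qed.

Lemma dot_self0 v : dot v v = 0 -> forall k, v k = 0.
Proof.
move=> v0 k; apply/eqP; rewrite -sqrf_eq0; apply/eqP.
apply: (psumr_eq0P (P := xpredT) (F := fun k => v k ^+ 2)) => //.
by move=> l _; exact: sqr_ge0.
Qed.

Lemma reflection_isometry v x :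
  dot (reflection v x) (reflection v x) = dot x x.
Proof.
have [v0|v0] := eqVneq (dot v v) 0.
  have -> : reflection v x = x.
    by apply/funext => k; rewrite /reflection (dot_self0 v0) mulr0 subr0.
  by [].
rewrite {2}/reflection dotBr (dotC _ x) (dotC _ v) !dotBr (dotC x v).
by field.
Qed.

(** Equal norms give [2 * dot v m = dot v v] for [v] the difference, so the reflection subtracts
    exactly [v] from [m]. The factor 1 puts [v] in the form of [dotBr]. *)
Lemma reflection_swap m m' : dot m m = dot m' m' ->
  reflection (fun k => m k - 1 * m' k) m = m'.
Proof.
move=> mm'; set v := (fun k => _); have [v0|v0] := eqVneq (dot v v) 0.
  apply/funext => k; rewrite /reflection (dot_self0 v0) mulr0 subr0.
  by apply/eqP; rewrite -subr_eq0 -(dot_self0 v0 k) /v mul1r.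
have vm : 2 * dot v m = dot v v.
  rewrite [in RHS]/v dotBr (dotC v m) (dotC v m') /v !dotBr (dotC m' m) mm'.
  by ring.
apply/funext => k; rewrite /reflection vm divff// mul1r /v; ring.
Qed.

End householder.

Section gaussian_norm.
Variables (R : realType) (n : nat).

(** Self-adjointness turns a projection of the reflected vector into a projection of [Y] along the
    reflected direction, whose law is given. Isometry preserves both [sqnorm] and the variance
    [\sum_(k < n) a k ^+ 2]. *)
Lemma gaussian_sqnorm_cdf d (T : measurableType d) (P : probability T R)
    (Y : T -> 'rV[R]_n) (m : 'rV[R]_n) (x : R) : (1 <= n)%N ->
  measurable_fun setT Y ->
  (forall (a : 'I_n -> R) (B : set (measurableTypeR R)), measurable B ->
    P [set w | B (\sum_(k < n) a k * Y w 0 k)] =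
    gauss_law (\sum_(k < n) a k * m 0 k) (Num.sqrt (\sum_(k < n) a k ^+ 2)) B) ->
  P [set w | sqnorm (Y w) <= x] = noncentral_chi2_cdf n x (sqnorm m).
Proof.
move=> n1 mY lawY.
set m' : 'rV[R]_n := \row_(k < n) if k == 0%N :> nat then Num.sqrt (sqnorm m) else 0.
have sq0 : 0 <= sqnorm m by rewrite sumr_ge0// => k _; rewrite sqr_ge0.
have dotE (y : 'rV[R]_n) : dot (y 0) (y 0) = sqnorm y by apply: eq_bigr.
have mm' : dot (m 0) (m 0) = dot (m' 0) (m' 0).
  rewrite !dotE [RHS]/sqnorm [RHS](bigD1 (Ordinal n1))//= [X in _ + X]big1 ?addr0.
    by rewrite mxE/= sqr_sqrtr.
  move=> k k0; rewrite mxE (_ : (k == 0%N :> nat) = false) ?expr0n//.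
  by apply/negbTE; move: k0; apply: contra => /eqP k0; apply/eqP/val_inj.
pose v : 'I_n -> R := fun k => m 0 k - 1 * m' 0 k.
pose OY (w : T) : 'rV[R]_n := \row_k reflection v (Y w 0) k.
have OYE w : OY w 0 = reflection v (Y w 0).
  by apply/funext => k; rewrite mxE.
have mOY : measurable_fun setT OY.
  apply/measurable_fun_rowP => k; under eq_fun do rewrite mxE.
  have mYk l := (measurable_fun_rowP Y).1 mY l.
  apply: measurable_funB => //; apply: measurable_funM => //.
  apply: measurable_funM => //; apply: measurable_funM => //.
  by apply: measurable_sum => l; exact: measurable_funM.
have sqOY w : sqnorm (OY w) = sqnorm (Y w).
  by rewrite -!dotE OYE reflection_isometry.
have mE : measurable [set y : 'rV[R]_n | sqnorm y <= x].
  rewrite -[X in measurable X]setTI.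
  exact: (measurable_fun_ler (@measurable_sqnorm R n) (measurable_cst x)).
transitivity (P (OY @^-1` [set y : 'rV[R]_n | sqnorm y <= x])).
  by congr (P _); apply/seteqP; split => w /=; rewrite sqOY.
rewrite (@cramer_wold _ _ _ _ _ _ P (standard_normal_at m') OY id)//.
move=> a B mB; rewrite [RHS](normal_product_proj (m' 0) a mB).
have -> : [set w | B (\sum_(k < n) a k * OY w 0 k)] =
    [set w | B (\sum_(k < n) reflection v a k * Y w 0 k)].
  apply/seteqP; split => w /=; rewrite -![\sum_(k < n) _]/(dot _ _);
  by rewrite reflection_adjoint OYE.
rewrite lawY//; congr (gauss_law _ _ B).
  by rewrite -[LHS]/(dot _ _) reflection_adjoint reflection_swap.
congr Num.sqrt; transitivity (dot (reflection v a) (reflection v a)).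
  by rewrite /dot; apply: eq_bigr => k _; rewrite expr2.
by rewrite reflection_isometry /dot; apply: eq_bigr => k _; rewrite expr2.
Qed.

End gaussian_norm.

(** * Covariances of linear combinations *)

Section covariance_linear.
Local Open Scope ereal_scope.
Context d (T : measurableType d) (R : realType) (P : probability T R).

Lemma Lfun2_sum (I : Type) (r : seq I) (a : I -> R) (X : I -> T -> R) :
  (forall l, X l \in Lfun P 2%:E) ->
  (fun w => \sum_(l <- r) a l * X l w)%R \in Lfun P 2%:E.
Proof.
move=> X2; elim: r => [|l r IH].
  rewrite (_ : (fun _ => _) = cst 0%R); first exact: Lfun_cst.
  by apply/funext => w; rewrite big_nil.
rewrite (_ : (fun _ => _) =
    ((a l \o* X l) \+ (fun w => \sum_(l <- r) a l * X l w))%R); last first.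
  by apply/funext => w; rewrite big_cons /= mulrC.
rewrite rpredD//=; first by rewrite lee1n.
by move=> _; apply: Lfun_scale => //; rewrite ler1n.
Qed.

Lemma covariance_suml (I : Type) (r : seq I) (a : I -> R) (X : I -> T -> R)
    (Y : T -> R) : (forall l, X l \in Lfun P 2%:E) -> Y \in Lfun P 2%:E ->
  covariance P (fun w => \sum_(l <- r) a l * X l w)%R Y =
  (\sum_(l <- r) a l * fine (covariance P (X l) Y))%R%:E.
Proof.
move=> X2 Y2; elim: r => [|l r IH].
  rewrite big_nil (_ : (fun _ => _) = cst 0%R) ?covariance_cst_l//.
  by apply/funext => w; rewrite big_nil.
rewrite (_ : (fun _ => _) =
    ((a l \o* X l) \+ (fun w => \sum_(l <- r) a l * X l w))%R); last first.
  by apply/funext => w; rewrite big_cons /= mulrC.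
rewrite covarianceDl//; last 2 first.
- by apply: Lfun_scale => //; rewrite ler1n.
- exact: Lfun2_sum.
have X1 := Lfun2_Lfun1 (X2 l); have Y1 := Lfun2_Lfun1 Y2.
have XY1 : (X l * Y)%R \in Lfun P 1 := Lfun2_mul_Lfun1 (X2 l) Y2.
by rewrite IH big_cons EFinD covarianceZl// EFinM fineK// covariance_fin_num.
Qed.

Lemma covariance_linear_forms (I : Type) (r : seq I) (a : I -> R)
    (X Y : I -> T -> R) :
  (forall l, X l \in Lfun P 2%:E) -> (forall l, Y l \in Lfun P 2%:E) ->
  covariance P (fun w => \sum_(l <- r) a l * X l w)%R
               (fun w => \sum_(l <- r) a l * Y l w)%R =
  (\sum_(l <- r) \sum_(l' <- r)
     a l * a l' * fine (covariance P (X l) (Y l')))%R%:E.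
Proof.
move=> X2 Y2; rewrite covariance_suml//; last exact: Lfun2_sum.
congr EFin; apply: eq_bigr => l _.
rewrite covarianceC covariance_suml//= mulr_sumr.
by apply: eq_bigr => l' _; rewrite mulrA covarianceC.
Qed.

End covariance_linear.

(** * Laws of the increments of the field *)

Section gaussian_increments.
Variables (R : realType) (d : nat).
Context {dT : measure_display} {T : measurableType dT}.
Variables (P : probability T R) (p : 'rV[int]_d -> {RV P >-> 'rV[R]_d}).
Variables (sigma : R) (rho : 'rV[int]_d -> R).
Hypothesis p_stationary : strictly_stationary P p.
Hypothesis p_gaussian : gaussian_field P p.
Hypothesis p_var : covariance_mx P (p 0) (p 0) = (sigma ^+ 2)%:M.
Hypothesis p_cov : forall i,
  covariance_mx P (p i) (p 0) = rho i *: (sigma ^+ 2)%:M.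

Let X (a : 'I_d -> R) i (w : T) : R := \sum_(l < d) a l * p i w 0 l.

Let measurable_p i l : measurable_fun setT (fun w => p i w 0 l).
Proof. exact: (measurableT_comp (measurable_row_coord l) (measurable_funP (p i))). Qed.

Let measurable_X a i : measurable_fun setT (X a i).
Proof. by apply: measurable_sum => l; exact: measurable_funM. Qed.

Lemma stationary_marginal (i : 'rV[int]_d) (B : set 'rV[R]_d) : measurable B ->
  P [set w | B (p i w)] = P [set w | B (p 0 w)].
Proof.
move=> mB; have := p_stationary (L := setT) i (A := [set f | B (f 0)]).
rewrite /= add0r => -> //.
apply: sub_sigma_algebra; exists 0 => //; by exists B.
Qed.

Let gaussian_X a i : is_gaussian P (X a i).
Proof.
have := p_gaussian [:: i] (fun _ => \row_l a l).
rewrite (_ : (fun w => _) = X a i)//; apply/funext => w.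
by rewrite big_seq1; apply: eq_bigr => l _; rewrite mxE.
Qed.

Let X_Lfun2 a i : X a i \in Lfun P 2%:E.
Proof.
have [m [s law]] := is_gaussian_law (gaussian_X a i).
exact: (gauss_Lfun2 (measurable_X a i) law).
Qed.

Let p_Lfun2 i l : (fun w => p i w 0 l) \in Lfun P 2%:E.
Proof.
rewrite (_ : (fun _ => _) = X (fun k => (k == l)%:R) i); first exact: X_Lfun2.
apply/funext => w; rewrite /X (bigD1 l)//= eqxx mul1r big1 ?addr0// => k /negbTE ->.
by rewrite mul0r.
Qed.

Let X_stationary a i (B : set (measurableTypeR R)) : measurable B ->
  P (X a i @^-1` B) = P (X a 0 @^-1` B).
Proof.
move=> mB; apply: (stationary_marginal i
  (B := [set x : 'rV[R]_d | B (\sum_(l < d) a l * x 0 l)])).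
rewrite -[X in measurable X]setTI; exact: (measurable_linear_form a).
Qed.

(** A Gaussian law is fixed by mean and variance. Stationarity gives both ends of the increment the
    same mean and variance, so the mean cancels and the variance is twice the common variance minus
    twice the covariance. *)
Lemma increment_law (i : 'rV[int]_d) (a : 'I_d -> R)
    (B : set (measurableTypeR R)) : i != 0 -> measurable B ->
  P [set w | B (\sum_(l < d) a l * (p i w 0 l - p 0 w 0 l))] =
  gauss_law 0
    (Num.sqrt (2 * sigma ^+ 2 * (1 - rho i) * \sum_(l < d) a l ^+ 2)) B.
Proof.
move=> i0 mB; pose D w := X a i w - X a 0 w.
have DE : (fun w => \sum_(l < d) a l * (p i w 0 l - p 0 w 0 l)) = D.
  by apply/funext => w; rewrite /D -sumrB; apply: eq_bigr => l _; rewrite mulrBr.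
have mD : measurable_fun setT D by exact: measurable_funB.
have gD : is_gaussian P D.
  (* Coefficients are functions of the index, so opposite ones at [i] and at 0 can be prescribed
     because [i != 0]. *)
  have := p_gaussian [:: i; 0] (fun j => if j == i then \row_l a l else \row_l - a l).
  rewrite (_ : (fun w => _) = D)//; apply/funext => w.
  rewrite big_cons big_seq1 eqxx eq_sym (negbTE i0) /D; congr (_ + _).
    by apply: eq_bigr => l _; rewrite mxE.
  by rewrite -sumrN; apply: eq_bigr => l _; rewrite mxE mulNr.
have [m [s law]] := is_gaussian_law gD.
have [mi [si lawi]] := is_gaussian_law (gaussian_X a i).
have [m0 [s0 law0]] := is_gaussian_law (gaussian_X a 0).
have law0i (C : set (measurableTypeR R)) : measurable C ->
    P (X a i @^-1` C) = gauss_law m0 s0 C.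
  by move=> mC; rewrite X_stationary// law0.
have mean0 : m = 0.
  have : ('E_P[X a i \- X a 0] = 0)%E.
    rewrite expectationB ?Lfun2_Lfun1//.
    rewrite (gauss_mean (measurable_X a i) law0i).
    by rewrite (gauss_mean (measurable_X a 0) law0) subee.
  by rewrite -[Z in ('E_P[Z])%E]/D (gauss_mean mD law) => -[].
have cov i' : covariance P (X a i') (X a 0) =
    (\sum_(l < d) \sum_(l' < d)
       a l * a l' * covariance_mx P (p i') (p 0) l l')%:E.
  rewrite covariance_linear_forms//; congr EFin; apply: eq_bigr => l _.
  by apply: eq_bigr => l' _; rewrite mxE.
have sum_diag c : \sum_(l < d) \sum_(l' < d)
    a l * a l' * (c%:M : 'M[R]_d) l l' = c * \sum_(l < d) a l ^+ 2.
  rewrite mulr_sumr; apply: eq_bigr => l _; rewrite (bigD1 l)//= big1 ?addr0.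
    by rewrite mxE eqxx mulr1n expr2 mulrC.
  by move=> l' /negbTE l'l; rewrite mxE eq_sym l'l mulr0n mulr0.
have s2 : s ^+ 2 = 2 * sigma ^+ 2 * (1 - rho i) * \sum_(l < d) a l ^+ 2.
  have := varianceB (X_Lfun2 a i) (X_Lfun2 a 0).
  rewrite -[Z in variance P Z]/D /variance (gauss_variance mD law).
  rewrite (gauss_variance (measurable_X a i) law0i).
  rewrite -(gauss_variance (measurable_X a 0) law0) !cov p_var p_cov.
  rewrite scale_scalar_mx !sum_diag -EFinM -EFinD => -[->].
  ring.
rewrite -[LHS]/(P ((fun w => \sum_(l < d) a l * (p i w 0 l - p 0 w 0 l)) @^-1` B)).
rewrite DE law// mean0; apply: gauss_law_sqr => //.
by rewrite -s2 sqrtr_sqr real_normK// num_real.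
Qed.

End gaussian_increments.

(** * Increments in balls and coincidences of points *)

Section increments_in_balls.
Variables (R : realType) (d : nat).
Context {dT : measure_display} {T : measurableType dT}.
Variables (P : probability T R) (p : 'rV[int]_d -> {RV P >-> 'rV[R]_d}).
Variables (sigma : R) (rho : 'rV[int]_d -> R).
Hypothesis p_stationary : strictly_stationary P p.
Hypothesis p_gaussian : gaussian_field P p.
Hypothesis p_var : covariance_mx P (p 0) (p 0) = (sigma ^+ 2)%:M.
Hypothesis p_cov : forall i,
  covariance_mx P (p i) (p 0) = rho i *: (sigma ^+ 2)%:M.
Hypothesis sigma2_gt0 : 0 < sigma ^+ 2.
Hypothesis rho_le1 : forall i, rho i <= 1.

Let kappa i := 2 * sigma ^+ 2 * (1 - rho i).

Let measurable_p i l : measurable_fun setT (fun w => p i w 0 l).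
Proof.
exact: (measurableT_comp (measurable_row_coord l) (measurable_funP (p i))).
Qed.

Lemma sqnormZ (c : R) (x : 'rV[R]_d) : sqnorm (c *: x) = c ^+ 2 * sqnorm x.
Proof.
by rewrite /sqnorm mulr_sumr; apply: eq_bigr => k _; rewrite mxE exprMn.
Qed.

Lemma sqnorm_ge0 (x : 'rV[R]_d) : 0 <= sqnorm x.
Proof. by rewrite sumr_ge0// => k _; rewrite sqr_ge0. Qed.

Lemma eballE (r : R) (x : 'rV[R]_d) : 0 <= r -> eball r x = (sqnorm x <= r ^+ 2).
Proof.
move=> r0; rewrite /eball /enorm /=; congr is_true.
by rewrite -[in RHS](sqr_sqrtr (sqnorm_ge0 x)) ler_sqr ?nnegrE ?sqrtr_ge0.
Qed.

Lemma increment_ball (i : 'rV[int]_d) (r : R) : (1 <= d)%N -> 0 <= r ->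
  i != 0 -> rho i != 1 ->
  P [set w | eball r (lattice_point R i + (p i w - p 0 w))] =
  noncentral_chi2_cdf d (r ^+ 2 / kappa i)
    (enorm (lattice_point R i) ^+ 2 / kappa i).
Proof.
move=> d1 r0 i0 rho1; set k := lattice_point R i.
have kappa0 : 0 < kappa i.
  by apply: mulr_gt0; [exact: mulr_gt0|rewrite subr_gt0 lt_neqAle rho1 rho_le1].
set c := (Num.sqrt (kappa i))^-1.
have c2 : c ^+ 2 = (kappa i)^-1 by rewrite exprVn sqr_sqrtr// ltW.
have c0 : 0 < c by rewrite invr_gt0 sqrtr_gt0.
pose Y w : 'rV[R]_d := c *: (k + (p i w - p 0 w)).
have -> : enorm k ^+ 2 / kappa i = sqnorm (c *: k).
  by rewrite sqnormZ c2 /enorm sqr_sqrtr ?sqnorm_ge0// mulrC.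
rewrite -(@gaussian_sqnorm_cdf R d _ _ P Y (c *: k))//.
- congr (P _); apply/funext => w; rewrite /mkset eballE// /Y sqnormZ c2.
  by rewrite [(kappa i)^-1 * _]mulrC ler_pM2r ?invr_gt0.
- apply/measurable_fun_rowP => l; under eq_fun do rewrite !mxE.
  apply: measurable_funM => //; apply: measurable_funD => //.
  exact: measurable_funB.
move=> a B mB.
pose b := \sum_(l < d) a l * (c *: k) 0 l.
(* The deterministic shift [b] and the scale [c] are moved into the set, leaving a linear form of
   the bare increment. *)
pose B' : set (measurableTypeR R) := [set t | B (b + c * t)].
have mB' : measurable B' by exact: measurable_affine_preimage.
have -> : [set w | B (\sum_(l < d) a l * Y w 0 l)] =
    [set w | B' (\sum_(l < d) a l * (p i w 0 l - p 0 w 0 l))].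
  have E w : \sum_(l < d) a l * Y w 0 l =
      b + c * \sum_(l < d) a l * (p i w 0 l - p 0 w 0 l).
    rewrite mulr_sumr -big_split/=; apply: eq_bigr => l _.
    by rewrite !mxE; ring.
  by apply/seteqP; split => w /=; rewrite E.
rewrite (increment_law p_stationary p_gaussian p_var p_cov)//.
rewrite -/(kappa i) sqrtrM ?ltW//.
rewrite /gauss_law; congr (normal_prob 0 1 _); apply/seteqP.
by split=> z; rewrite /B'/= add0r !mulrA mulVf ?mul1r// gt_eqF// sqrtr_gt0.
Qed.

Lemma coordinate_increment_law (i : 'rV[int]_d) (l : 'I_d)
    (B : set (measurableTypeR R)) : i != 0 -> measurable B ->
  P [set w | B (p i w 0 l - p 0 w 0 l)] = gauss_law 0 (Num.sqrt (kappa i)) B.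
Proof.
move=> i0 mB.
rewrite -[X in gauss_law 0 (Num.sqrt X)]mulr1.
have -> : 1 = \sum_(k < d) ((k == l)%:R : R) ^+ 2.
  rewrite (bigD1 l)//= eqxx expr1n big1 ?addr0// => k /negbTE ->.
  by rewrite expr0n.
rewrite -(increment_law p_stationary p_gaussian p_var p_cov)//.
congr (P _); apply/seteqP; split => w /=.
  rewrite (bigD1 l)//= eqxx mul1r big1 ?addr0// => k /negbTE ->.
  by rewrite mul0r.
rewrite (bigD1 l)//= eqxx mul1r big1 ?addr0// => k /negbTE ->.
by rewrite mul0r.
Qed.

Lemma degenerate_increment (i : 'rV[int]_d) : i != 0 -> rho i = 1 ->
  {ae P, forall w, p i w = p 0 w}.
Proof.
move=> i0 rho1.
have H l : {ae P, forall w, p i w 0 l = p 0 w 0 l}.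
  exists [set w | [set~ 0] (p i w 0 l - p 0 w 0 l)]; split.
  - rewrite -[X in measurable X]setTI.
    apply: (measurable_funB (measurable_p i l) (measurable_p 0 l)) => //.
    exact: measurableC.
  - rewrite coordinate_increment_law//; last exact: measurableC.
    rewrite /kappa rho1 subrr mulr0 sqrtr0 gauss_law_dirac diracE memNset//.
    by move=> /(_ erefl).
  - by move=> w /= /eqP; rewrite -subr_eq0 => /eqP.
have : {ae P, forall w, forall l, p i w 0 l = p 0 w 0 l}.
  exact: filter_forall.
by apply: filterS => w pE; apply/rowP.
Qed.

Lemma gauss_law_set1 (m s c : R) : s != 0 -> gauss_law m s [set c] = 0%E.
Proof.
move=> s0; rewrite gauss_law_normal//.
have /null_content_dominatesP dom := @normal_prob_dominates R m s.
by apply: dom; [exact: measurable_set1|exact: lebesgue_measure_set1].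
Qed.

(** Two points can coincide only if all coordinates do, so one suitable coordinate suffices. If
    [rho i = 1], a nonzero coordinate of [i] works since the increment vanishes; otherwise the
    coordinate laws have no atoms. *)
Lemma lattice_increment_neq0 (i : 'rV[int]_d) : (1 <= d)%N -> i != 0 ->
  exists l : 'I_d,
    P [set w | p i w 0 l - p 0 w 0 l = - lattice_point R i 0 l] = 0%E.
Proof.
move=> d1 i0.
suff [l Pl] : exists l : 'I_d,
    gauss_law 0 (Num.sqrt (kappa i)) [set - lattice_point R i 0 l] = 0%E.
  by exists l; rewrite -Pl -(coordinate_increment_law l i0).
have [rho1|rho1] := eqVneq (rho i) 1.
  have [l il] : exists l, i 0 l != 0.
    apply/existsP; rewrite -negb_forall; apply: contra i0 => /forallP i0.
    by apply/eqP/rowP => l; rewrite mxE; apply/eqP.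
  exists l; rewrite /kappa rho1 subrr mulr0 sqrtr0 gauss_law_dirac diracE.
  rewrite memNset//= => /esym/eqP; rewrite oppr_eq0 mxE intr_eq0.
  exact/negP.
exists (Ordinal d1); apply: gauss_law_set1.
rewrite sqrtr_eq0 -ltNge; apply: mulr_gt0; first exact: mulr_gt0.
by rewrite subr_gt0 lt_neqAle rho1 rho_le1.
Qed.

End increments_in_balls.

(** * The point process *)

Section countable_sums.
Local Open Scope ereal_scope.

(** The integral of a nonnegative function is a supremum over the simple functions below it, which
    is monotone for arbitrary functions. *)
Lemma ge0_le_integral_gen d (T : measurableType d) (R : realType)
    (mu : {measure set T -> \bar R}) (f g : T -> \bar R) :
  (forall x, 0 <= f x) -> (forall x, f x <= g x) ->
  \int[mu]_x f x <= \int[mu]_x g x.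
Proof.
move=> f0 fg; have g0 x : 0 <= g x by exact: le_trans (f0 x) (fg x).
rewrite !ge0_integralTE//; apply: ge_ereal_sup => _ [h hf <-].
by apply: ereal_sup_ubound; exists h => // x; exact: le_trans (hf x) (fg x).
Qed.

(* Measurability of [f] is not assumed because the integrand of
   [reduced_moment2] is compared with a measurable function only off a null set. *)
Lemma ge0_ae_eq_integral_gen d (T : measurableType d) (R : realType)
    (mu : {measure set T -> \bar R}) (f g : T -> \bar R) :
  (forall x, 0 <= f x) -> (forall x, 0 <= g x) -> measurable_fun setT g ->
  {ae mu, forall x, f x = g x} ->
  \int[mu]_x f x = \int[mu]_x g x.
Proof.
move=> f0 g0 mg [N [mN N0 fgN]].
have fg x : ~ N x -> f x = g x by move=> Nx; apply: contra_notP Nx; exact: fgN.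
have patch_int (h : T -> \bar R) : measurable_fun setT h -> (forall x, 0 <= h x) ->
    (forall x, ~ N x -> h x = g x) -> \int[mu]_x h x = \int[mu]_x g x.
  move=> mh h0 hg; apply: ge0_ae_eq_integral => //.
  exists N; split => // x /= /not_implyP[_] hgx.
  by apply: contrapT => Nx; apply: hgx; exact: hg.
(* [f] lies between [c 0] and [c +oo], two measurable functions that differ from [g] only on the
   null set [N]. *)
pose c (v : \bar R) x := if x \in N then v else g x.
have mc v : measurable_fun setT (c v).
  apply: measurable_fun_ifT => //; apply: (measurable_fun_bool true).
  rewrite setTI (_ : _ @^-1` _ = N)//.
  by apply/seteqP; split => x /=; [exact: set_mem|exact: mem_set].
have cg v x : ~ N x -> c v x = g x by move=> Nx; rewrite /c memNset.
apply/eqP; rewrite eq_le; apply/andP; split.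
  rewrite -(patch_int (c +oo)) //; last 2 first.
  - by move=> x; rewrite /c; case: ifP.
  - exact: cg.
  apply: ge0_le_integral_gen => // x; rewrite /c; case: ifPn => [_|/negP Nx].
    exact: leey.
  by rewrite fg// => Nx'; apply: Nx; rewrite inE.
rewrite -(patch_int (c 0)) //; last 2 first.
- by move=> x; rewrite /c; case: ifP.
- exact: cg.
apply: ge0_le_integral_gen => x; rewrite /c; case: ifPn => // /negP Nx.
by rewrite fg// => Nx'; apply: Nx; rewrite inE.
Qed.

(** A series over the naturals gives access to measurability and termwise integration. [pickle_inv]
    is used because several codes may have the same image under [unpickle]; here each index is
    counted once. *)
Lemma esum_countType (R : realType) (I : countType) (D : set I)
    (a : I -> \bar R) : (forall i, 0 <= a i) ->
  \esum_(i in D) a i =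
  \sum_(n <oo) if pickle_inv n is Some i then
                 if i \in D then a i else 0 else 0.
Proof.
move=> a0.
pose b n := if @pickle_inv I n is Some i then
              if i \in D then a i else 0 else 0.
have b0 n : 0 <= b n by rewrite /b; case: pickle_inv => // i; case: ifP.
rewrite nneseries_esumT//.
transitivity (\esum_(n in pickle @` D) b n).
  rewrite (reindex_esum D _ pickle); last first.
    apply: inj_bij => x y _ _; exact: (pcan_inj pickleK).
  by apply: eq_esum => i Di; rewrite /b pickleK_inv mem_set.
rewrite [LHS]esum_mkcond; apply: eq_esum => n _; case: ifPn => // nD.
rewrite /b; have := @pickle_invK I n; case: pickle_inv => //= i in_.
case: ifPn => //; rewrite inE => Di; exfalso; move/negP: nD; apply.
by rewrite inE; exists i => //; move: in_; rewrite /ocancel/=.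
Qed.

Lemma measurable_esum d (T : measurableType d) (R : realType) (I : countType)
    (D : set I) (f : I -> T -> \bar R) :
  (forall i, measurable_fun setT (f i)) -> (forall i x, 0 <= f i x) ->
  measurable_fun setT (fun x => \esum_(i in D) f i x).
Proof.
move=> mf f0.
under eq_fun do rewrite esum_countType//.
apply: ge0_emeasurable_sum => n.
  by move=> x _ _; case: pickle_inv => // i; case: ifP.
by move=> _; move: (@pickle_inv I n) => [i|] //; move: (i \in D) => [].
Qed.

Lemma integral_esum d (T : measurableType d) (R : realType)
    (mu : {measure set T -> \bar R}) (I : countType)
    (D : set I) (f : I -> T -> \bar R) :
  (forall i, measurable_fun setT (f i)) -> (forall i x, 0 <= f i x) ->
  \int[mu]_x (\esum_(i in D) f i x) = \esum_(i in D) \int[mu]_x f i x.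
Proof.
move=> mf f0.
under eq_integral do rewrite esum_countType//.
rewrite integral_nneseries//.
- rewrite esum_countType//; last by move=> i; exact: integral_ge0.
  apply: eq_eseriesr => n _; case: pickle_inv => [i|]; last exact: integral0.
  by case: ifP => // _; exact: integral0.
- by move=> n; move: (@pickle_inv I n) => [i|] //; move: (i \in D) => [].
- by move=> n x _; case: pickle_inv => [i|]//; case: ifP.
Qed.

Lemma ae_forall_countType d (T : measurableType d) (R : realType)
    (mu : {measure set T -> \bar R}) (I : countType) (Q : I -> T -> Prop) :
  (forall i, {ae mu, forall x, Q i x}) -> {ae mu, forall x, forall i, Q i x}.
Proof.
move=> aeQ.
have : {ae mu, forall x, forall n,
    (if unpickle n is Some i then Q i else fun=> True) x}.
  apply: ae_foralln => n; case: unpickle => [i|]; first exact: aeQ.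
  exact: aeW.
apply: filterS => x Qx i; have := Qx (pickle i); by rewrite pickleK.
Qed.

Lemma counting_esum (R : realType) (I : choiceType) (D : set I) :
  counting D = \esum_(i in D) (1 : \bar R).
Proof.
have sum1 (F : seq I) : \sum_(i <- F) (1 : \bar R) = (size F)%:R%:E.
  by rewrite sumEFin big_const_seq count_predT iter_addr_0.
rewrite /counting; case: ifPn => [/asboolP finD|/asboolPn infD].
  by rewrite esum_fset// fsbig_finite//= sum1.
apply/esym/eq_infty => x.
have [F FD nF] := infinite_set_fset (Num.bound `|x|) infD.
apply: esum_ge; eexists; first by split; [exact: finite_fset|exact: FD].
rewrite fsbig_finite//= set_fsetK sum1 lee_fin.
apply: le_trans (ler_norm x) _; apply/ltW.
by apply: lt_le_trans (archi_boundP (normr_ge0 x)) _; rewrite ler_nat.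
Qed.

End countable_sums.

(** * Atoms and lattice translates *)

Section lattice_points.
Variables (R : realType) (d : nat).

Lemma points_dirac_sum (X : 'rV[int]_d -> 'rV[R]_d) :
  points (fun A => \esum_(i in [set: 'rV[int]_d]) \d_(X i) A)%E = range X.
Proof.
apply/seteqP; split => x /=.
  move=> nu0; apply: contrapT => nX; move: nu0.
  rewrite /points /= esum1 ?ltxx// => i _; rewrite diracE memNset//= => Xix.
  by apply: nX; exists i.
move=> [i _ <-]; rewrite /points /=; apply: (@lt_le_trans _ _ 1%E) => //.
apply: esum_ge; exists [set i]; first by split.
by rewrite fsbig_set1 diracE mem_set.
Qed.

Lemma esum_distinct_points (X : 'rV[int]_d -> 'rV[R]_d)
    (f : 'rV[R]_d * 'rV[R]_d -> \bar R) :
  injective X ->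
  (\esum_(xy in [set xy : 'rV[R]_d * 'rV[R]_d |
      [/\ range X xy.1, range X xy.2 & xy.1 <> xy.2]]) f xy =
   \esum_(ij in [set ij : 'rV[int]_d * 'rV[int]_d | ij.1 <> ij.2])
      f (X ij.1, X ij.2))%E.
Proof.
move=> injX.
apply: (reindex_esum _ _ (fun ij => (X ij.1, X ij.2))); split.
- move=> [i j] /= ij; split; [by exists i|by exists j|].
  by move=> /injX.
- by move=> [i j] [i' j'] _ _ [/injX -> /injX ->].
- by move=> [x y] [/= [i _ <-] [j _ <-] ij]; exists (i, j) => //= e; apply: ij; rewrite e.
Qed.

Lemma lattice_pointB (i j : 'rV[int]_d) :
  lattice_point R (i - j) = lattice_point R i - lattice_point R j.
Proof. by apply/rowP => k; rewrite !mxE rmorphB. Qed.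

Lemma lattice_pointD (i j : 'rV[int]_d) :
  lattice_point R (i + j) = lattice_point R i + lattice_point R j.
Proof. by apply/rowP => k; rewrite !mxE rmorphD. Qed.

(** The cube is closed, so an integer coordinate would allow two translates; off the integers only
    minus the floor remains. *)
Lemma unique_cube_translate (y : 'rV[R]_d) :
  (forall (k : 'I_d) (z : int), y 0 k <> z%:~R) ->
  exists i : 'rV[int]_d, forall j : 'rV[int]_d,
    unit_cube (lattice_point R j + y) <-> j = i.
Proof.
move=> yZ; exists (\row_k - Num.floor (y 0 k)) => j; split => [cj|-> k].
  apply/rowP => k; rewrite mxE; have := cj k; rewrite !mxE => /andP[h1 h2].
  have h1' : 0 < (j 0 k)%:~R + y 0 k.
    rewrite lt_neqAle h1 andbT; apply/eqP => e; apply: (yZ k (- j 0 k)).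
    by rewrite rmorphN /=; lra.
  have h2' : (j 0 k)%:~R + y 0 k < 1.
    rewrite lt_neqAle h2 andbT; apply/eqP => e; apply: (yZ k (1 - j 0 k)).
    by rewrite rmorphB /=; lra.
  rewrite (@floor_def _ (y 0 k) (- j 0 k)) ?opprK//.
  by rewrite rmorphD rmorphN /=; lra.
rewrite !mxE rmorphN /=; have := floor_le (y 0 k); have := floorD1_gt (y 0 k).
by rewrite rmorphD /=; lra.
Qed.

End lattice_points.

(** * Coordinates of the uniform law have no atoms *)

Section uniform_cube_atoms.
Variable R : realType.

Lemma product_probability_coord0 n
    (Q : 'I_n -> probability (measurableTypeR R) R) (k : 'I_n) (c : R) :
  Q k [set c] = 0%E -> product_probability Q [set u | u 0 k = c] = 0%E.
Proof.
elim: n Q k => [|n IH] Q k Qk0; first by case: k Qk0 => [[]].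
have mS (m : nat) (l : 'I_m) : measurable [set u : 'rV[R]_m | u 0 l = c].
  rewrite -[X in measurable X]setTI.
  exact: (measurable_row_coord l measurableT (measurable_set1 c)).
pose pp : probability 'rV[R]_n R :=
  product_probability (fun l : 'I_n => Q (lift ord0 l)).
rewrite -[LHS]/((Q ord0 \x pp)%E (@cons_row R n @^-1` [set u | u 0 k = c])).
have [l kE|kE] := unliftP ord0 k.
  have -> : @cons_row R n @^-1` [set u | u 0 k = c] =
      setT `*` [set u : 'rV[R]_n | u 0 l = c].
    apply/seteqP; split=> -[x u] /=; rewrite /cons_row mxE kE liftK //=.
      by case.
  rewrite product_measure1E//; last exact: mS.
  rewrite -[RHS](mule0 (Q ord0 setT)).
  by congr (_ * _)%E; apply: IH; rewrite -kE.
have -> : @cons_row R n @^-1` [set u | u 0 k = c] =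
      [set c] `*` [set: 'rV[R]_n].
  apply/seteqP; split=> -[x u] /=; rewrite /cons_row mxE kE unlift_none //=.
    by case.
rewrite product_measure1E//.
by move: Qk0; rewrite kE => Q0; rewrite -[RHS](mul0e (pp setT)); congr (_ * _)%E.
Qed.

Lemma uniform_cube_coord0 n (k : 'I_n) (c : R) :
  uniform_cube R n [set u | u 0 k = c] = 0%E.
Proof.
apply: product_probability_coord0.
have /null_content_dominatesP dom := dominates_uniform_prob (@ltr01 R).
by apply: dom; [exact: measurable_set1|exact: lebesgue_measure_set1].
Qed.

End uniform_cube_atoms.

(** * The measurable space of fields *)

Section field_space.
Variables (R : realType) (d : nat).

(** The generators of [field_events setT], named so that fields form a measurable type whose product
    with the range of [U] can be taken. *)
Definition field_generator : set (set ('rV[int]_d -> 'rV[R]_d)) :=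
  [set A | exists2 i, [set: 'rV[int]_d] i &
           exists2 B, measurable B & A = [set f | B (f i)]].

Definition field_space := g_sigma_algebraType field_generator.

HB.instance Definition _ := Measurable.on field_space.

Lemma measurable_field_eval (i : 'rV[int]_d) :
  measurable_fun [set: field_space] (fun f : field_space => f i).
Proof.
by move=> _ B mB; rewrite setTI; apply: sub_sigma_algebra; exists i => //; exists B.
Qed.

Lemma measurable_to_field dT (T : measurableType dT) (phi : T -> field_space) :
  (forall i, measurable_fun setT (fun w => phi w i)) -> measurable_fun setT phi.
Proof.
move=> mphi; have H := @measurability _ _ T field_space setT phi field_generator.
apply: H; first exact: erefl.
by move=> _ [_ [i _ [B mB ->]] <-]; exact: mphi.
Qed.

Definition field_shift (j : 'rV[int]_d) (f : field_space) : field_space :=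
  fun i => f (i + j).

Lemma field_shift0 f : field_shift 0 f = f.
Proof. by apply/funext => i; rewrite /field_shift addr0. Qed.

Lemma measurable_field_shift j : measurable_fun setT (field_shift j).
Proof. by apply: measurable_to_field => i; exact: measurable_field_eval. Qed.

End field_space.

(** * Joint law of the shifted field and [U] *)

Section joint_law.
Variables (R : realType) (d : nat).
Context {dT : measure_display} {T : measurableType dT}.
Variables (P : probability T R) (p : 'rV[int]_d -> {RV P >-> 'rV[R]_d})
  (U : {RV P >-> 'rV[R]_d}).
Hypothesis p_stationary : strictly_stationary P p.
Hypothesis U_uniform : has_law P U (uniform_cube R d).
Hypothesis U_independent : independent_of_field P U p.

Definition field_of (w : T) : field_space R d := fun i => p i w.

Lemma measurable_field_of : measurable_fun setT field_of.
Proof. by apply: measurable_to_field => i; exact: measurable_funP. Qed.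

Let mp_field : {mfun T >-> field_space R d} :=
  HB.pack field_of (isMeasurableFun.Build _ _ _ _ _ measurable_field_of).

Let pair_at j (w : T) : field_space R d * 'rV[R]_d :=
  (field_shift j (field_of w), U w).

Let measurable_pair_at j : measurable_fun setT (pair_at j).
Proof.
apply: measurable_fun_pair; last exact: measurable_funP.
exact: (measurableT_comp (measurable_field_shift j) measurable_field_of).
Qed.

Let mpair_at j : {mfun T >-> (field_space R d * 'rV[R]_d)%type} :=
  HB.pack (pair_at j) (isMeasurableFun.Build _ _ _ _ _ (measurable_pair_at j)).

(** On a rectangle, independence splits the probability and stationarity removes the shift [j]; a
    product measure is determined by its values on rectangles. *)
Lemma joint_law j (S : set (field_space R d * 'rV[R]_d)) : measurable S ->
  P [set w | S (field_shift j (field_of w), U w)] =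
  (distribution P mp_field \x uniform_cube R d)%E S.
Proof.
move=> mS; apply/esym.
have H := @product_measure_unique _ _ _ _ _ (distribution P mp_field)
  (uniform_cube R d) (distribution P (mpair_at j)).
apply: (H _ S mS) => A B mA mB.
have mA' : measurable (field_shift j @^-1` A).
  by rewrite -[X in measurable X]setTI; exact: measurable_field_shift.
transitivity (P (U @^-1` B `&`
    [set w | (field_shift j @^-1` A) (fun i => p i w)])).
  by congr (P _); apply/seteqP; split => w [].
rewrite U_independent// U_uniform// muleC; congr (_ * _)%E.
have := p_stationary (L := setT) j mA; rewrite /mkset => <-.
by congr (P _); apply/seteqP; split => w.
Qed.

Lemma joint_stationary j (S : set (field_space R d * 'rV[R]_d)) : measurable S ->
  P [set w | S (field_shift j (field_of w), U w)] = P [set w | S (field_of w, U w)].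
Proof.
move=> mS; rewrite joint_law// -(joint_law 0)//.
by congr (P _); apply/seteqP; split => w; rewrite /= field_shift0.
Qed.

(** For a fixed field, coordinate [k] of [U] would have to equal a given number, a null event; there
    are countably many pairs of [k] and [z]. *)
Lemma ae_noninteger :
  {ae P, forall w, forall (k : 'I_d) (z : int), (p 0 w + U w) 0 k <> z%:~R}.
Proof.
apply: (ae_forall_countType (I := 'I_d)) => k.
apply: (ae_forall_countType (I := int)) => z.
pose S : set (field_space R d * 'rV[R]_d) :=
  [set s : field_space R d * 'rV[R]_d | (s.1 0 + s.2) 0 k = z%:~R].
have mS : measurable S.
  rewrite -[S]setTI.
  have mf : measurable_fun [set: field_space R d * 'rV[R]_d]
     (fun s : field_space R d * 'rV[R]_d => s.1 0 0 k + s.2 0 k).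
    apply: measurable_funD.
      have m0 : measurable_fun setT
          (fun s : field_space R d * 'rV[R]_d => s.1 0).
        exact: (measurableT_comp (@measurable_field_eval R d 0) measurable_fst).
      exact: (measurableT_comp (measurable_row_coord k) m0).
    exact: (measurableT_comp (measurable_row_coord k) measurable_snd).
  rewrite (_ : S = (fun s : field_space R d * 'rV[R]_d =>
      s.1 0 0 k + s.2 0 k) @^-1` [set z%:~R]).
    by apply: mf => //; exact: measurable_set1.
  by apply/seteqP; split => s; rewrite /S /= mxE.
have mSw : measurable [set w | S (field_of w, U w)].
  rewrite -[X in measurable X]setTI.
  have mpair : measurable_fun setT (fun w => (field_of w, U w)).
    apply: measurable_fun_pair; [exact: measurable_field_of|exact: measurable_funP].
  exact: mpair.
exists [set w | S (field_of w, U w)]; split => //.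
  apply: (etrans (esym (joint_stationary 0 mS))); rewrite joint_law//.
  rewrite /product_measure1/=; apply: integral0_eq => f _ /=.
  rewrite (_ : xsection S f = [set u | u 0 k = z%:~R - f 0 0 k]).
    exact: uniform_cube_coord0.
  apply/seteqP; split => u; rewrite /xsection /S /= inE /= mxE.
    by move=> <-; rewrite addrAC subrr add0r.
  by move=> ->; rewrite addrC subrK.
by move=> w /= /contrapT.
Qed.

End joint_law.

(** * Measurability of vector operations, balls and the cube *)

Section row_measurability.
Variables (R : realType) (d : nat).

Lemma measurable_rowD dT (T : measurableType dT) (f g : T -> 'rV[R]_d) :
  measurable_fun setT f -> measurable_fun setT g ->
  measurable_fun setT (fun w => f w + g w).
Proof.
move=> /measurable_fun_rowP mf /measurable_fun_rowP mg.
apply/measurable_fun_rowP => k; under eq_fun do rewrite mxE.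
exact: measurable_funD.
Qed.

Lemma measurable_rowB dT (T : measurableType dT) (f g : T -> 'rV[R]_d) :
  measurable_fun setT f -> measurable_fun setT g ->
  measurable_fun setT (fun w => f w - g w).
Proof.
move=> /measurable_fun_rowP mf /measurable_fun_rowP mg.
apply/measurable_fun_rowP => k; under eq_fun do rewrite !mxE.
exact: measurable_funB.
Qed.

Lemma measurable_eball (r : R) : measurable (@eball R d r).
Proof.
have [r0|r0] := leP 0 r.
  have -> : @eball R d r = [set x | sqnorm x <= r ^+ 2].
    by apply/funext => x; rewrite eballE.
  rewrite -[X in measurable X]setTI.
  exact: (measurable_fun_ler (@measurable_sqnorm R d) (measurable_cst (r ^+ 2))).
have -> : @eball R d r = set0.
  apply/seteqP; split => // x; rewrite /eball /= => /(le_trans (sqrtr_ge0 _)).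
  by rewrite leNgt r0.
exact: measurable0.
Qed.

Lemma measurable_unit_cube : measurable (@unit_cube R d).
Proof.
have -> : @unit_cube R d =
    \bigcap_(k in [set: 'I_d]) (row_coord k @^-1` `[0%R, 1%R]%classic).
  apply/seteqP; split => x; rewrite /unit_cube /= => h k.
    by move=> _; rewrite /row_coord /= in_itv /=.
  by have := h k I; rewrite /row_coord /= in_itv.
apply: fin_bigcap_measurable => // k _; rewrite -[X in measurable X]setTI.
exact: (measurable_row_coord k measurableT (measurable_itv _)).
Qed.

End row_measurability.

(** * The K-function as a sum over increments *)

Section K_function.
Variables (R : realType) (d : nat).
Hypothesis d_ge1 : (1 <= d)%N.
Context {dT : measure_display} {T : measurableType dT}.
Variables (P : probability T R) (p : 'rV[int]_d -> {RV P >-> 'rV[R]_d})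
  (U : {RV P >-> 'rV[R]_d}).
Variables (sigma : R) (rho : 'rV[int]_d -> R).
Hypothesis p_stationary : strictly_stationary P p.
Hypothesis p_gaussian : gaussian_field P p.
Hypothesis U_uniform : has_law P U (uniform_cube R d).
Hypothesis U_independent : independent_of_field P U p.
Hypothesis p_var : covariance_mx P (p 0) (p 0) = (sigma ^+ 2)%:M.
Hypothesis p_cov : forall i,
  covariance_mx P (p i) (p 0) = rho i *: (sigma ^+ 2)%:M.
Hypothesis sigma2_gt0 : 0 < sigma ^+ 2.
Hypothesis rho_le1 : forall i, rho i <= 1.

Let X i w := lattice_point R i + p i w + U w.

Let joint := joint_stationary p_stationary U_uniform U_independent.

Let m_eval i : measurable_fun setT
  (fun s : field_space R d * 'rV[R]_d => s.1 i).
Proof. exact: (measurableT_comp (@measurable_field_eval R d i) measurable_fst). Qed.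

Let m_setT dT' (T' : measurableType dT') (f : T' -> 'rV[R]_d) (B : set 'rV[R]_d) :
  measurable_fun setT f -> measurable B -> measurable [set w | B (f w)].
Proof. by move=> mf mB; rewrite -[X in measurable X]setTI; exact: mf. Qed.

Let m_X i : measurable_fun setT (X i).
Proof.
apply: measurable_rowD; last exact: measurable_funP.
by apply: measurable_rowD; [exact: measurable_cst|exact: measurable_funP].
Qed.

(** In a coincidence of points [i] and [j] the common [U] cancels; a shift by [i] turns it into an
    event on the increment at [j - i], null by [lattice_increment_neq0]. *)
Lemma ae_injective_points : {ae P, forall w, injective (X ^~ w)}.
Proof.
have aeX : {ae P, forall w, forall i j, i <> j -> X i w <> X j w}.
  apply: (ae_forall_countType (I := 'rV[int]_d)) => i.
  apply: (ae_forall_countType (I := 'rV[int]_d)) => j.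
  have [->|ij] := eqVneq i j; first exact: aeW.
  have k0 : j - i != 0 by rewrite subr_eq0 eq_sym.
  have [l Pl] := lattice_increment_neq0 p_stationary p_gaussian p_var p_cov
    sigma2_gt0 rho_le1 d_ge1 k0.
  pose S : set (field_space R d * 'rV[R]_d) :=
    [set s : field_space R d * 'rV[R]_d | [set - lattice_point R (j - i) 0 l]
      ((s.1 (j - i) - s.1 0) 0 l)].
  have mS : measurable S.
    have := measurable_rowB (m_eval (j - i)) (m_eval 0).
    move=> /(measurableT_comp (measurable_row_coord l)) ms.
    by rewrite -[S]setTI; apply: ms => //; exact: measurable_set1.
  exists [set w | S (field_shift i (field_of p w), U w)]; split.
  - have mij := measurable_rowB (measurable_funP (p (j - i + i)))
      (measurable_funP (p (0 + i))).
    move: mij => /(measurableT_comp (measurable_row_coord l)) mij.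
    rewrite -[X in measurable X]setTI.
    by apply: mij => //; exact: measurable_set1.
  - apply: (etrans (joint i mS)); rewrite -[RHS]Pl; congr (P _).
    by apply/seteqP; split => w; rewrite /S /= /field_of !mxE.
  - move=> w /= /not_implyP[_ /contrapT]; rewrite /X => /addIr Xij.
    rewrite /S /field_shift /field_of /= subrK add0r lattice_pointB !mxE.
    have := congr1 (fun v : 'rV[R]_d => v 0 l) Xij; rewrite !mxE.
    lra.
apply: filterS aeX => w Xw i j Xij; apply: contrapT => ij.
exact: (Xw i j).
Qed.

Let C i w := unit_cube (lattice_point R i + (p 0 w + U w)).

Lemma cube_partition (D : set T) : measurable D ->
  (\esum_(i in [set: 'rV[int]_d]) P [set w | C i w /\ D w] = P D)%E.
Proof.
move=> mD.
have mC i : measurable [set w | C i w /\ D w].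
  apply: measurableI => //; apply: m_setT; last exact: measurable_unit_cube.
  apply: measurable_rowD; first exact: measurable_cst.
  by apply: measurable_rowD; exact: measurable_funP.
transitivity (\int[P]_w (\esum_(i in [set: 'rV[int]_d])
    (\1_[set w | C i w /\ D w] w)%:E))%E.
  rewrite (@integral_esum _ _ _ _ 'rV[int]_d); last 2 first.
  - by move=> i; exact/measurable_EFinP/measurable_indic.
  - by move=> i w; rewrite lee_fin.
  by apply: eq_esum => i _; rewrite integral_indic// setIT.
transitivity (\int[P]_w (\1_D w)%:E)%E; last by rewrite integral_indic// setIT.
apply: ge0_ae_eq_integral_gen.
- by move=> w; apply: esum_ge0 => i _; rewrite lee_fin.
- by move=> w; rewrite lee_fin.
- exact/measurable_EFinP/measurable_indic.
apply: filterS (ae_noninteger p_stationary U_uniform U_independent) => w nint.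
have [i0 Ci0] := unique_cube_translate nint.
transitivity (\esum_(i in [set i0]) (\1_D w)%:E : \bar R)%E; last first.
  by rewrite esum_set1.
rewrite [RHS]esum_mkcond; apply: eq_esum => i _.
case: ifPn => [/set_mem ->|/negP ii0].
  rewrite !indicE; congr ((nat_of_bool _)%:R)%:E; apply/idP/idP; rewrite !inE/=.
    by case.
  by move=> Dw; split => //; apply/Ci0.
by rewrite indicE memNset//= => -[/Ci0 ii _]; apply: ii0; rewrite inE.
Qed.

Let D r k w := eball r (lattice_point R k + (p k w - p 0 w)).

Let measurable_D r k : measurable [set w | D r k w].
Proof.
apply: m_setT; last exact: measurable_eball.
apply: measurable_rowD; first exact: measurable_cst.
by apply: measurable_rowB; exact: measurable_funP.
Qed.

(** The shift by [i] acts on the field only: the offset [lattice_point R i] stays in the cube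
    condition, and it is over this offset that [cube_partition] sums. *)
Lemma pair_probability r i k :
  P [set w | unit_cube (X i w) /\ eball r (X (i + k) w - X i w)] =
  P [set w | C i w /\ D r k w].
Proof.
pose S : set (field_space R d * 'rV[R]_d) :=
  [set s : field_space R d * 'rV[R]_d |
    unit_cube (lattice_point R i + (s.1 0 + s.2)) /\
    eball r (lattice_point R k + (s.1 k - s.1 0))].
have mS : measurable S.
  apply: measurableI.
    apply: m_setT; last exact: measurable_unit_cube.
    apply: measurable_rowD; first exact: measurable_cst.
    exact: measurable_rowD.
  apply: m_setT; last exact: measurable_eball.
  apply: measurable_rowD; first exact: measurable_cst.
  exact: measurable_rowB.
rewrite -[RHS](joint i mS); congr (P _).
apply/funext => w; rewrite /S /mkset /field_shift /field_of /= add0r (addrC k i).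
rewrite /X lattice_pointD addrA; congr (_ /\ eball r _).
by apply/rowP => l; rewrite !mxE; ring.
Qed.

Lemma degenerate_probability r k : {ae P, forall w, p k w = p 0 w} ->
  P [set w | D r k w] = if k \in [set i | eball r (lattice_point R i)] then 1%E else 0%E.
Proof.
move=> pk; transitivity (\int[P]_w (\1_[set w | D r k w] w)%:E)%E.
  by rewrite integral_indic// setIT.
transitivity (\int[P]_w (if k \in [set i | eball r (lattice_point R i)]
    then 1%E else 0%E))%E; last first.
  by case: ifP => _; rewrite integral_cst//= ?mul0e// probability_setT mul1e.
apply: ge0_ae_eq_integral_gen.
- by move=> w; rewrite lee_fin.
- by move=> w; case: ifP.
- exact: measurable_cst.
apply: filterS pk => w pkw; rewrite indicE /D.
rewrite (_ : (w \in _) = (k \in [set i | eball r (lattice_point R i)])).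
  by case: ifP.
by apply/idP/idP; rewrite !inE /= pkw subrr addr0.
Qed.

Lemma K_function_sum r :
  (K_function P (perturbed_lattice p U) r =
   \esum_(k in [set k | k <> 0%R]) P [set w | D r k w])%E.
Proof.
pose E (ij : 'rV[int]_d * 'rV[int]_d) : set T :=
  [set w | unit_cube (X ij.1 w) /\ eball r (X ij.2 w - X ij.1 w)].
have mE ij : measurable (E ij).
  apply: measurableI; apply: m_setT.
  - exact: m_X.
  - exact: measurable_unit_cube.
  - exact: measurable_rowB.
  - exact: measurable_eball.
transitivity (\int[P]_w (\esum_(ij in [set ij : 'rV[int]_d * 'rV[int]_d |
    ij.1 <> ij.2]) (\1_(E ij) w)%:E))%E.
  apply: ge0_ae_eq_integral_gen.
  - by move=> w; apply: esum_ge0 => xy _; rewrite lee_fin.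
  - by move=> w; apply: esum_ge0 => ij _; rewrite lee_fin.
  - apply: (measurable_esum (I := ('rV[int]_d * 'rV[int]_d)%type)).
      by move=> ij; exact/measurable_EFinP/measurable_indic.
    by move=> ij w; rewrite lee_fin.
  apply: filterS ae_injective_points => w injX.
  rewrite (_ : points (perturbed_lattice p U w) = range (X ^~ w)); last first.
    exact: points_dirac_sum.
  by rewrite esum_distinct_points.
rewrite (@integral_esum _ _ _ _ ('rV[int]_d * 'rV[int]_d)%type); last 2 first.
- by move=> ij; exact/measurable_EFinP/measurable_indic.
- by move=> ij w; rewrite lee_fin.
under eq_esum do rewrite integral_indic// setIT.
(* Ordered pairs of distinct indices are parametrised by the difference [k] and the first index [i],
   so that the inner sum runs over [i] for a fixed increment. *)
rewrite (reindex_esum ([set k : 'rV[int]_d | k <> 0] `*`` fun=> [set: 'rV[int]_d]) _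
  (fun ki => (ki.2, ki.2 + ki.1))); last first.
  split.
  - move=> [k i] /= [k0 _] e; apply: k0.
    by apply: (addrI i); rewrite addr0 -e.
  - by move=> [k i] [k' i'] _ _ [-> /addrI ->].
  - move=> [i j] /= ij; exists (j - i, i) => /=.
      by split => // /eqP; rewrite subr_eq0 => /eqP ji; apply: ij.
    by rewrite addrC subrK.
rewrite -(@esum_esum _ _ _ _ (fun=> setT) (fun k i => P (E (i, i + k))))//.
apply: eq_esum => k _; rewrite -(cube_partition (measurable_D r k)).
by apply: eq_esum => i _; exact: pair_probability.
Qed.

End K_function.

Theorem proposition1 (R : realType) (d : nat) (d_ge1 : (1 <= d)%N)
    (dT : measure_display) (T : measurableType dT) (P : probability T R)
    (p : 'rV[int]_d -> {RV P >-> 'rV[R]_d}) (U : {RV P >-> 'rV[R]_d})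
    (mu : 'rV[R]_d) (sigma : R) (rho : 'rV[int]_d -> R)
    (p_stationary : strictly_stationary P p)
    (p_gaussian : gaussian_field P p)
    (p_mean : has_mean P p mu)
    (U_uniform : has_law P U (uniform_cube R d))
    (U_independent : independent_of_field P U p)
    (sigma2_gt0 : 0 < sigma ^+ 2)
    (rho_itv : forall i, -1 <= rho i <= 1) :
  let Sigma := covariance_mx P (p 0) (p 0) in
  let C := fun i => covariance_mx P (p i) (p 0) in
  let A := [set i : 'rV[int]_d | i <> 0 /\ rho i = 1] in
  let kappa := fun i => 2 * sigma ^+ 2 * (1 - rho i) in
  Sigma = (sigma ^+ 2)%:M ->
  (forall i, C i = rho i *: Sigma) ->
  forall r : R, 0 <= r ->
    K_function P (perturbed_lattice p U) r =
    (counting (A `&` [set i | eball r (lattice_point R i)]) +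
     \esum_(i in ~` (A `|` [set 0%R]))
       noncentral_chi2_cdf d (r ^+ 2 / kappa i)%R
         (enorm (lattice_point R i) ^+ 2 / kappa i)%R)%E.
Proof.
move=> Sigma C A kappa SigmaE CE r r0.
have p_cov i : covariance_mx P (p i) (p 0) = rho i *: (sigma ^+ 2)%:M.
  by rewrite -SigmaE; exact: CE.
have rho_le1 i : rho i <= 1 by case/andP: (rho_itv i).
rewrite (K_function_sum d_ge1 p_stationary p_gaussian U_uniform U_independent
  SigmaE p_cov sigma2_gt0 rho_le1).
(* On [A] each probability is 0 or 1 according to whether the lattice point lies in the ball, so
   these terms count points; off [A] and 0, [kappa] is positive. *)
rewrite [LHS](esumID A)//; congr (_ + _)%E.
  rewrite counting_esum (_ : [set k | k <> 0] `&` A = A); last first.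
    by apply/seteqP; split => k; [case|move=> Ak; split => //; case: Ak].
  rewrite [RHS]esum_mkcondr; apply: eq_esum => k [k0 rho1].
  have k0' : k != 0 by apply/eqP.
  apply: degenerate_probability.
  exact: (degenerate_increment p_stationary p_gaussian SigmaE p_cov).
rewrite (_ : [set k | k <> 0] `&` ~` A = ~` (A `|` [set 0])); last first.
  by rewrite setCU setIC.
apply: eq_esum => k kA.
have k0 : k != 0 by apply/eqP => k0; apply: kA; right.
have rho1 : rho k != 1.
  by apply/eqP => rho1; apply: kA; left; split => //; exact/eqP.
exact: (increment_ball p_stationary p_gaussian SigmaE p_cov sigma2_gt0 rho_le1).
Qed.
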